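(* Let $H$ be a finite dimensional semisimple Hopf algebra over $\mathbb{C}$, let $K$ be a normal Hopf subalgebra of $H$ and let $L=H//K$. Consider the equivalence relation $r^{H^*}_{L^*,k}$ on $\mathrm{Irr}(H)$, written $\sim$. Then for $\chi,\mu\in\mathrm{Irr}(H)$ one has $\chi\sim\mu$ if and only if $$\frac{1}{\chi(1)}\,\chi\!\downarrow_K=\frac{1}{\mu(1)}\,\mu\!\downarrow_K .$$
   Context: $k=\mathbb{C}$. $\mathrm{Irr}(H)$ is the set of irreducible characters of $H$, and $\chi\!\downarrow_K$ denotes restriction of a character to $K$. $H//K=H/HK^+$, where $K^+=K\cap\ker\epsilon$; since $K$ is normal this is a quotient Hopf algebra $L$ of $H$, and the projection $\pi:H\to L$ dualizes to an injective Hopf algebra map $\pi^*:L^*\to H^*$, through which $L^*$ is regarded as a Hopf subalgebra of $H^*$. For $\chi\in\mathrm{Irr}(H)$ let $C_\chi\subset H^*$ be the simple subcoalgebra of $H^*$ associated to $\chi$ (the span of the matrix coefficients of the corresponding simple $H$-module). The equivalence relation $r^{H^*}_{L^*,k}$ on $\mathrm{Irr}(H)$ is defined by: $\chi\sim\mu$ if and only if $C_\chi\subset L^*C_\mu$ (product in $H^*$). Equivalently, $m_H(\chi,t_L\mu)>0$, where $t_L\in L^*\subset H^*$ is the integral of $L^*$ with $t_L(1)=\dim_k L$ (the regular character of $L$ viewed as a character of $H$), the product is that of $H^*$, and $m_H$ is the bilinear form on the span of the characters of $H$ with $m_H(\chi_M,\chi_N)=\dim_k\mathrm{Hom}_H(M,N)$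 for $H$-modules $M,N$ with characters $\chi_M,\chi_N$. *)

(* Defs.v *)
From HB Require Import structures.
From mathcomp Require Import all_boot all_order all_algebra all_field.
From mathcomp Require Import boolp reals complex.

Set Implicit Arguments.
Unset Strict Implicit.
Unset Printing Implicit Defensive.

Import GRing.Theory.
Local Open Scope ring_scope.

Definition bilin (F : fieldType) (U V W : lmodType F) (f : U -> V -> W) :=
  (forall v, linear (fun u => f u v)) /\ (forall u, linear (f u)).

Lemma linear_pack (F : fieldType) (U V : lmodType F) (f : U -> V) :
  linear f -> exists g : {linear U -> V}, f = g.
Proof.
move=> lin_f; pose m := GRing.isLinear.Build F U V *:%R f lin_f.
by exists (HB.pack f m : {linear U -> V}).
Qed.

Lemma linfunE (F : fieldType) (U V : vectType F) (f : U -> V) :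
  linear f -> forall u, linfun f u = f u.
Proof. by move=> /linear_pack[g ->] u; rewrite lfunE. Qed.

(* V (x) W is modelled by matrices indexed by bases of V and W; [tns v w] is
   the pure tensor, and [tlift f] is the linear map induced by f.  Lemmas
   tliftE and tens_ind below give the universal property.                    *)
Definition tens (F : fieldType) (V W : vectType F) : Type :=
  'M[F]_(\dim {:V}, \dim {:W}).
HB.instance Definition _ (F : fieldType) (V W : vectType F) :=
  Vector.copy (tens V W) 'M[F]_(\dim {:V}, \dim {:W}).

Definition tns (F : fieldType) (V W : vectType F) (v : V) (w : W) : tens V W :=
  \matrix_(i, j) (coord (vbasis {:V}) i v * coord (vbasis {:W}) j w).

Definition tlift (F : fieldType) (V W : vectType F) (U : lmodType F)
    (f : V -> W -> U) (t : tens V W) : U :=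
  \sum_i \sum_j
    (t : 'M[F]_(\dim {:V}, \dim {:W})) i j *:
      f (vbasis {:V})`_i (vbasis {:W})`_j.

(* Sweedler notation: \sw_(a, b <- t) E is the image of t under the linear map
   a (x) b |-> E.                                                            *)
Notation "\sw_ ( a , b <- t ) E" := (tlift (fun a b => E) t)
  (at level 41, a name, b name, t at level 60, E at level 41,
   format "\sw_ ( a ,  b  <-  t )  E") : ring_scope.

Section Tensor.
Variable F : fieldType.
Implicit Types (V W : vectType F) (U : lmodType F).

Lemma tlift_linear V W U (f : V -> W -> U) : linear (tlift f).
Proof.
move=> c s t; rewrite /tlift scaler_sumr -big_split; apply: eq_bigr => i _ /=.
rewrite scaler_sumr -big_split; apply: eq_bigr => j _ /=.
by rewrite !mxE scalerDl scalerA.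
Qed.

HB.instance Definition _ V W U (f : V -> W -> U) :=
  GRing.isLinear.Build F (tens V W) U *:%R (tlift f) (tlift_linear f).

Lemma eq_tlift V W U (f g : V -> W -> U) t :
  (forall a b, f a b = g a b) -> tlift f t = tlift g t.
Proof. by move=> fg; apply: eq_bigr => i _; apply: eq_bigr => j _; rewrite fg. Qed.

Lemma linear_tlift V W U U' (g : U -> U') (f : V -> W -> U) t :
  linear g -> g (tlift f t) = \sw_(a, b <- t) g (f a b).
Proof.
move=> /linear_pack[{}g ->]; rewrite linear_sum; apply: eq_bigr => i _.
by rewrite linear_sum; apply: eq_bigr => j _; rewrite linearZ.
Qed.

Lemma exchange_tlift V W V' W' U (f : V -> W -> V' -> W' -> U) s t :
  \sw_(a, b <- s) \sw_(c, d <- t) f a b c d =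
  \sw_(c, d <- t) \sw_(a, b <- s) f a b c d.
Proof.
rewrite [LHS](_ : _ = \sum_i \sum_j \sum_k \sum_l
  ((s : 'M_(_, _)) i j * (t : 'M_(_, _)) k l) *:
   f (vbasis {:V})`_i (vbasis {:W})`_j (vbasis {:V'})`_k (vbasis {:W'})`_l).
  rewrite [RHS](_ : _ = \sum_k \sum_l \sum_i \sum_j
  ((s : 'M_(_, _)) i j * (t : 'M_(_, _)) k l) *:
   f (vbasis {:V})`_i (vbasis {:W})`_j (vbasis {:V'})`_k (vbasis {:W'})`_l).
    under eq_bigr => i _ do rewrite exchange_big.
    rewrite exchange_big; apply: eq_bigr => k _ /=.
    under eq_bigr => i _ do rewrite exchange_big.
    by rewrite exchange_big.
  apply: eq_bigr => k _; apply: eq_bigr => l _; rewrite scaler_sumr.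
  apply: eq_bigr => i _; rewrite scaler_sumr; apply: eq_bigr => j _.
  by rewrite scalerA mulrC.
apply: eq_bigr => k _; apply: eq_bigr => l _; rewrite scaler_sumr.
by apply: eq_bigr => i _; rewrite scaler_sumr; apply: eq_bigr => j _; rewrite scalerA.
Qed.

Lemma bilin_sum V W U (f : V -> W -> U) v w : bilin f ->
  f v w = \sum_i \sum_j (coord (vbasis {:V}) i v * coord (vbasis {:W}) j w) *:
           f (vbasis {:V})`_i (vbasis {:W})`_j.
Proof.
move=> [linl linr].
have [fl Dfl] := linear_pack (linl w).
rewrite -[LHS]/((fun u => f u w) v) Dfl [in LHS](coord_vbasis (memvf v)) linear_sum.
apply: eq_bigr => i _; rewrite linearZ -Dfl /=.
have [fr Dfr] := linear_pack (linr (vbasis {:V})`_i).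
rewrite [in LHS](coord_vbasis (memvf w)) Dfr linear_sum scaler_sumr.
by apply: eq_bigr => j _; rewrite linearZ /= scalerA.
Qed.

Lemma tliftE V W U (f : V -> W -> U) v w :
  bilin f -> tlift f (tns v w) = f v w.
Proof.
move=> bf; rewrite [RHS](bilin_sum v w bf).
by apply: eq_bigr => i _; apply: eq_bigr => j _; rewrite mxE.
Qed.

Lemma tns_bilin V W : bilin (@tns F V W).
Proof.
split=> u c v w; apply/matrixP=> i j; rewrite !mxE linearP /=.
  by rewrite mulrDl mulrA.
by rewrite mulrDr mulrCA.
Qed.

Lemma tnsZl V W c (v : V) (w : W) : tns (c *: v) w = c *: tns v w.
Proof. by apply/matrixP=> i j; rewrite !mxE linearZ /= mulrA. Qed.

Lemma tnsZr V W c (v : V) (w : W) : tns v (c *: w) = c *: tns v w.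
Proof. by apply/matrixP=> i j; rewrite !mxE linearZ /= mulrCA. Qed.

Lemma tensE V W (t : tens V W) : t = \sw_(a, b <- t) tns a b.
Proof.
apply/matrixP=> i j.
have E (k : 'I_(\dim {:V})) (l : 'I_(\dim {:W})) :
    (tns (vbasis {:V})`_k (vbasis {:W})`_l : 'M_(_, _)) i j =
    ((k == i) && (l == j))%:R.
  rewrite mxE !coord_free ?(basis_free (vbasisP _)) // mulr_natl mulrb.
  by case: eqP.
rewrite /tlift summxE (bigD1 i) //= summxE (bigD1 j) //=.
rewrite mxE E !eqxx mulr1 !big1 ?addr0 // => [k ki|k kj].
  by rewrite summxE big1 // => l _; rewrite mxE E (negPf ki) mulr0.
by rewrite mxE E (negPf kj) andbF mulr0.
Qed.

Lemma tens_ind V W U (f g : tens V W -> U) : linear f -> linear g ->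
  (forall v w, f (tns v w) = g (tns v w)) -> forall t, f t = g t.
Proof.
move=> lf lg fg t; rewrite [t]tensE (linear_tlift _ _ lf) (linear_tlift _ _ lg).
exact: eq_tlift.
Qed.

End Tensor.

Definition tmul (F : fieldType) (A : falgType F) (s t : tens A A) : tens A A :=
  \sw_(a, b <- s) \sw_(c, d <- t) tns (a * c) (b * d).

HB.mixin Record Falgebra_isHopf (F : fieldType) H of Falgebra F H := {
  comult : 'Hom(H, tens H H);
  counit : 'Hom(H, F^o);
  antipode : 'End(H);
  comultA : forall h,
    \sw_(a, b <- comult h) \sw_(a1, a2 <- comult a) tns (tns a1 a2) b =
    \sw_(a, b <- comult h) \sw_(b1, b2 <- comult b) tns (tns a b1) b2;
  counitl : forall h, \sw_(a, b <- comult h) ((counit a : F) *: b) = h;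
  counitr : forall h, \sw_(a, b <- comult h) ((counit b : F) *: a) = h;
  comult1 : comult 1 = tns 1 1;
  comultM : forall g h, comult (g * h) = tmul (comult g) (comult h);
  counit1 : counit 1 = 1;
  counitM : forall g h, counit (g * h) = counit g * counit h;
  antipodel : forall h, \sw_(a, b <- comult h) (antipode a * b) = (counit h : F) *: 1;
  antipoder : forall h, \sw_(a, b <- comult h) (a * antipode b) = (counit h : F) *: 1
}.

#[short(type="hopfAlgType")]
HB.structure Definition HopfAlgebra (F : fieldType) :=
  { H of Falgebra F H & Falgebra_isHopf F H }.

Section LinearClosure.
Variable F : fieldType.
Implicit Types (U V W X : vectType F) (L M : lmodType F) (A : falgType F).

Lemma lin_id L : linear (fun x : L => x).
Proof. by []. Qed.

Lemma lin_mull L A (a : A) (g : L -> A) : linear g -> linear (fun x => a * g x).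
Proof. by move=> lg c x y; rewrite lg mulrDr scalerAr. Qed.

Lemma lin_mulr L A (a : A) (g : L -> A) : linear g -> linear (fun x => g x * a).
Proof. by move=> lg c x y; rewrite lg mulrDl scalerAl. Qed.

Lemma lin_scaler L M c (g : L -> M) : linear g -> linear (fun x => c *: g x).
Proof. by move=> lg d x y; rewrite lg scalerDr !scalerA mulrC. Qed.

Lemma lin_scalel L M (m : M) (g : L -> F^o) :
  linear g -> linear (fun x => (g x : F) *: m).
Proof. by move=> lg d x y; rewrite lg scalerDl scalerA. Qed.

Lemma lin_lfun L U V (f : 'Hom(U, V)) (g : L -> U) :
  linear g -> linear (fun x => f (g x)).
Proof. by move=> lg d x y; rewrite lg linearP. Qed.

Lemma lin_tnsl L V W (w : W) (g : L -> V) : linear g -> linear (fun x => tns (g x) w).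
Proof. by move=> lg d x y; rewrite lg (tns_bilin V W).1. Qed.

Lemma lin_tnsr L V W (v : V) (g : L -> W) : linear g -> linear (fun x => tns v (g x)).
Proof. by move=> lg d x y; rewrite lg (tns_bilin V W).2. Qed.

Lemma lin_tlift L M V W (f : V -> W -> M) (g : L -> tens V W) :
  linear g -> linear (fun x => tlift f (g x)).
Proof. by move=> lg d x y; rewrite lg linearP. Qed.

Lemma lin_tlift_fun L M V W (f : L -> V -> W -> M) t :
  (forall a b, linear (fun x => f x a b)) -> linear (fun x => tlift (f x) t).
Proof.
move=> lf d x y; rewrite /tlift scaler_sumr -big_split; apply: eq_bigr => i _ /=.
rewrite scaler_sumr -big_split; apply: eq_bigr => j _ /=.
by rewrite lf scalerDr !scalerA mulrC.
Qed.

Lemma lin_mul_reg L (a : F) (g : L -> F^o) :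
  linear g -> linear (fun x => a * g x : F^o).
Proof. by move=> lg c x y; rewrite lg mulrDr; congr (_ + _); rewrite /GRing.scale /= mulrCA. Qed.

Lemma lin_mul_regr L (a : F) (g : L -> F^o) :
  linear g -> linear (fun x => g x * a : F^o).
Proof. by move=> lg c x y; rewrite lg mulrDl; congr (_ + _); rewrite /GRing.scale /= mulrA. Qed.

End LinearClosure.

Lemma scale_tlift (F : fieldType) (V W : vectType F) (U : lmodType F) c
    (f : V -> W -> U) t : c *: tlift f t = \sw_(a, b <- t) (c *: f a b).
Proof. by apply: linear_tlift; apply: lin_scaler; apply: lin_id. Qed.

Lemma mul_tlift (F : fieldType) (V W : vectType F) (A : falgType F) (x : A)
    (f : V -> W -> A) t : x * tlift f t = \sw_(a, b <- t) (x * f a b).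
Proof.
by apply: (linear_tlift (g := fun y : A => x * y)); apply: lin_mull; apply: lin_id.
Qed.

Lemma tlift_mul (F : fieldType) (V W : vectType F) (A : falgType F) (x : A)
    (f : V -> W -> A) t : tlift f t * x = \sw_(a, b <- t) (f a b * x).
Proof.
by apply: (linear_tlift (g := fun y : A => y * x)); apply: lin_mulr; apply: lin_id.
Qed.

Ltac lin :=
  match goal with
  | |- bilin _ => split=> ? /=; lin
  | |- linear _ => first
     [ exact: lin_id
     | apply: lin_mul_reg; lin | apply: lin_mul_regr; lin
     | apply: lin_mull; lin | apply: lin_mulr; lin
     | apply: lin_lfun; lin
     | apply: lin_scaler; lin | apply: lin_scalel; lin
     | apply: lin_tnsl; lin | apply: lin_tnsr; lin
     | apply: lin_tlift; lin
     | apply: lin_tlift_fun => ? ? /=; lin ]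
  end.

Section HopfTheory.
Variables (F : fieldType) (H : hopfAlgType F).
Implicit Types (a b c d g h k : H).

Lemma tlift_mem (V W X : vectType F) (U : {vspace X}) (f : V -> W -> X) t :
  (forall v w, f v w \in U) -> tlift f t \in U.
Proof. by move=> fU; do 2!apply: memv_suml => ? _; apply: memvZ. Qed.

Lemma comult_assoc (U : lmodType F) (f : H -> H -> H -> U) h :
  (forall a b, linear (f a b)) -> (forall a c, linear (fun b => f a b c)) ->
  (forall b c, linear (fun a => f a b c)) ->
  \sw_(a, b <- comult h) \sw_(a1, a2 <- comult a) f a1 a2 b =
  \sw_(a, b <- comult h) \sw_(b1, b2 <- comult b) f a b1 b2.
Proof.
move=> f3 f2 f1.
pose G (t : tens (tens H H) H) := \sw_(ab, c <- t) \sw_(a, b <- ab) f a b c.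
have lG : linear G by apply: lin_tlift; exact: lin_id.
have GE a b c : G (tns (tns a b) c) = f a b c.
  rewrite /G tliftE; first by rewrite tliftE //; split.
  split=> u; first by lin.
  by apply: lin_tlift_fun.
have := congr1 G (comultA h); rewrite !(linear_tlift _ _ lG) => E.
transitivity (\sw_(a, b <- comult h) G (\sw_(a1, a2 <- comult a) tns (tns a1 a2) b)).
  by apply: eq_tlift => a b; rewrite (linear_tlift _ _ lG); apply: eq_tlift => *; rewrite GE.
rewrite E; apply: eq_tlift => a b; rewrite (linear_tlift _ _ lG).
by apply: eq_tlift => *; rewrite GE.
Qed.

Lemma comultM_lift (U : lmodType F) (f : H -> H -> U) g h : bilin f ->
  tlift f (comult (g * h)) =
  \sw_(a, b <- comult g) \sw_(c, d <- comult h) f (a * c) (b * d).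
Proof.
move=> bf; rewrite comultM /tmul (linear_tlift (g := tlift f)); last exact: tlift_linear.
apply: eq_tlift => a b; rewrite (linear_tlift (g := tlift f)); last exact: tlift_linear.
by apply: eq_tlift => c d; rewrite tliftE.
Qed.

Lemma antipode1 : antipode (1 : H) = 1.
Proof.
have := antipodel (1 : H); rewrite comult1 tliftE ?mulr1 ?counit1 ?scale1r //.
by lin.
Qed.

Lemma counitl_lfun (V : vectType F) (f : H -> V) h : linear f ->
  \sw_(a, b <- comult h) ((counit a : F) *: f b) = f h.
Proof.
move=> lf; rewrite -[in RHS](counitl h) (linear_tlift _ _ lf).
by apply: eq_tlift => a b; have [g ->] := linear_pack lf; rewrite linearZ.
Qed.

Lemma counitr_lfun (V : vectType F) (f : H -> V) h : linear f ->
  \sw_(a, b <- comult h) ((counit b : F) *: f a) = f h.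
Proof.
move=> lf; rewrite -[in RHS](counitr h) (linear_tlift _ _ lf).
by apply: eq_tlift => a b; have [g ->] := linear_pack lf; rewrite linearZ.
Qed.

Lemma counit_antipode h : counit (antipode h) = counit h.
Proof.
have := congr1 counit (antipodel h); rewrite linearZ /= counit1 (linear_tlift (g := counit)).
  under eq_tlift => a b do rewrite counitM mulrC.
  rewrite (@counitr_lfun _ (fun a => counit (antipode a))); last by lin.
  by rewrite [_ *: _]mulr1.
exact: linearP.
Qed.

Lemma antipodeM g h : antipode (g * h) = antipode h * antipode g.
Proof.
pose f (a1 c1 a2 c2 b d : H) :=
  (antipode (a1 * c1) * (a2 * c2)) * (antipode d * antipode b).
pose X1 := \sw_(a, b <- comult g) \sw_(c, d <- comult h)
  \sw_(b1, b2 <- comult b) \sw_(d1, d2 <- comult d) f a c b1 d1 b2 d2.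
pose X2 := \sw_(a, b <- comult g) \sw_(c, d <- comult h)
  \sw_(a1, a2 <- comult a) \sw_(c1, c2 <- comult c) f a1 c1 a2 c2 b d.
have E1 : X1 = antipode (g * h).
  rewrite -(@counitr_lfun _ (fun x => antipode (x * h)) g); last by lin.
  apply: eq_tlift => a b.
  rewrite -(@counitr_lfun _ (fun x => antipode (a * x)) h); last by lin.
  rewrite scale_tlift; apply: eq_tlift => c d.
  transitivity (\sw_(b1, b2 <- comult b) ((counit d : F) *: (antipode (a * c) * (b1 * antipode b2)))).
    apply: eq_tlift => b1 b2.
    transitivity (antipode (a * c) *
      (b1 * ((\sw_(d1, d2 <- comult d) (d1 * antipode d2)) * antipode b2))).
      by rewrite tlift_mul !mul_tlift; apply: eq_tlift => d1 d2; rewrite /f !mulrA.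
    by rewrite antipoder -scalerAl mul1r -!scalerAr.
  by rewrite -scale_tlift -mul_tlift antipoder -scalerAr mulr1 !scalerA mulrC.
have E2 : X2 = antipode h * antipode g.
  rewrite -(@counitl_lfun _ (fun x => antipode h * antipode x) g); last by lin.
  apply: eq_tlift => a b.
  rewrite -(@counitl_lfun _ (fun x => antipode x * antipode b) h); last by lin.
  rewrite scale_tlift; apply: eq_tlift => c d.
  transitivity ((\sw_(x, y <- comult (a * c)) (antipode x * y))
                 * (antipode d * antipode b)).
    rewrite comultM_lift; last by lin.
    by rewrite tlift_mul; apply: eq_tlift => a1 a2; rewrite tlift_mul.
  by rewrite antipodel -scalerAl mul1r counitM scalerA.
rewrite -E1 -E2 /X1 /X2.
under eq_tlift => a b do rewrite exchange_tlift.
under [RHS]eq_tlift => a b do rewrite exchange_tlift.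
rewrite -(@comult_assoc _ (fun a b1 b2 => \sw_(c, d <- comult h)
   \sw_(d1, d2 <- comult d) f a c b1 d1 b2 d2)) /f; [|move=> *; by lin ..].
apply: eq_tlift => a b; apply: eq_tlift => a1 a2.
by rewrite -(@comult_assoc _ (fun c d1 d2 => f a1 c a2 d1 b d2)) // => *; rewrite /f; lin.
Qed.

End HopfTheory.

Definition dual (F : fieldType) (H : hopfAlgType F) : Type := 'Hom(H, F^o).
HB.instance Definition _ (F : fieldType) (H : hopfAlgType F) :=
  Vector.copy (dual H) 'Hom(H, F^o).

Definition conv (F : fieldType) (H : hopfAlgType F) (f g : dual H) : dual H :=
  linfun (fun h : H => \sw_(a, b <- comult h) (f a * g b : F^o)).

Section DualAlgebra.
Variables (F : fieldType) (H : hopfAlgType F).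
Implicit Types (f g e : dual H) (h : H).

Lemma convE f g h : conv f g h = \sw_(a, b <- comult h) (f a * g b : F^o).
Proof. by rewrite linfunE //; lin. Qed.

Let convA : associative (@conv F H).
Proof.
move=> f g e; apply/lfunP => h; rewrite !convE.
pose p (a b c : H) : F^o := f a * g b * e c.
transitivity (\sw_(a, b <- comult h) \sw_(b1, b2 <- comult b) p a b1 b2).
  apply: eq_tlift => a b; rewrite convE.
  rewrite (linear_tlift (g := fun x : F^o => (f a * x : F^o))); last by lin.
  by apply: eq_tlift => *; rewrite /p mulrA.
rewrite -comult_assoc /p; [|move=> *; by lin ..].
apply: eq_tlift => a b; rewrite convE.
by rewrite (linear_tlift (g := fun x : F^o => (x * e b : F^o))) //; lin.
Qed.

Let conv1l : left_id (counit : dual H) (@conv F H).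
Proof.
by move=> f; apply/lfunP => h; rewrite convE; apply: counitl_lfun; lin.
Qed.

Let conv1r : right_id (counit : dual H) (@conv F H).
Proof.
move=> f; apply/lfunP => h; rewrite convE -[RHS]counitr_lfun; last by lin.
by apply: eq_tlift => a b; rewrite mulrC.
Qed.

Let convDl : left_distributive (@conv F H) +%R.
Proof.
move=> f g e; apply/lfunP => h; rewrite lfunE /= !convE.
rewrite /tlift -big_split; apply: eq_bigr => i _ /=.
rewrite -big_split; apply: eq_bigr => j _ /=.
by rewrite -scalerDr lfunE mulrDl.
Qed.

Let convDr : right_distributive (@conv F H) +%R.
Proof.
move=> f g e; apply/lfunP => h; rewrite lfunE /= !convE.
rewrite /tlift -big_split; apply: eq_bigr => i _ /=.
rewrite -big_split; apply: eq_bigr => j _ /=.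
by rewrite -scalerDr lfunE mulrDr.
Qed.

Let conv1_neq0 : (counit : dual H) != 0.
Proof.
apply/eqP => /(congr1 (fun f : 'Hom(H, F^o) => f 1)).
by rewrite counit1 lfunE => /eqP; rewrite oner_eq0.
Qed.

HB.instance Definition _ := GRing.Zmodule_isNzRing.Build (dual H)
  convA conv1l conv1r convDl convDr conv1_neq0.

Let convZl k f g : k *: (f * g) = (k *: f) * g.
Proof.
apply/lfunP => h; rewrite lfunE /= !convE scale_tlift; apply: eq_tlift => a b.
by rewrite lfunE [LHS]mulrA.
Qed.
HB.instance Definition _ := GRing.Lmodule_isLalgebra.Build F (dual H) convZl.

Let convZr k f g : k *: (f * g) = f * (k *: g).
Proof.
apply/lfunP => h; rewrite lfunE /= !convE scale_tlift; apply: eq_tlift => a b.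
by rewrite lfunE [LHS]mulrCA.
Qed.
HB.instance Definition _ := GRing.Lalgebra_isAlgebra.Build F (dual H) convZr.

HB.instance Definition _ := Algebra_isFalgebra.Build F (dual H).

Lemma dual_mulE f g h : (f * g) h = \sw_(a, b <- comult h) (f a * g b : F^o).
Proof. exact: convE. Qed.

End DualAlgebra.

Definition tensv (F : fieldType) (V W : vectType F)
    (A : {vspace V}) (B : {vspace W}) : {vspace tens V W} :=
  <<[seq tns u w | u <- vbasis A, w <- vbasis B]>>%VS.

Lemma tensv_eq (F : fieldType) (V W X : vectType F) (A : {vspace V})
    (B : {vspace W}) (f g : tens V W -> X) t : linear f -> linear g ->
  (forall u w, u \in A -> w \in B -> f (tns u w) = g (tns u w)) ->
  t \in tensv A B -> f t = g t.
Proof.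
move=> lf lg fg; suff /subvP: (tensv A B <= lker (linfun f - linfun g))%VS.
  move=> /[apply]; rewrite memv_ker add_lfunE opp_lfunE !linfunE //.
  by rewrite subr_eq0 => /eqP.
apply/span_subvP => _ /allpairsP[[u w] /= [/vbasis_mem Au /vbasis_mem Bw ->]].
by rewrite memv_ker add_lfunE opp_lfunE !linfunE // fg // subrr.
Qed.

(* The last two fields are stability under the left and right adjoint actions. *)
Record normal_hopf_subalg (F : fieldType) (H : hopfAlgType F)
    (K : {vspace H}) : Prop := NormalHopfSubalg {
  nhs_one : 1 \in K;
  nhs_mul : forall x y, x \in K -> y \in K -> x * y \in K;
  nhs_comult : forall x, x \in K -> comult x \in tensv K K;
  nhs_antipode : forall x, x \in K -> antipode x \in K;
  nhs_adl : forall h x, x \in K ->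
    \sw_(a, b <- comult h) (a * x * antipode b) \in K;
  nhs_adr : forall h x, x \in K ->
    \sw_(a, b <- comult h) (antipode a * x * b) \in K
}.

Definition augv (F : fieldType) (H : hopfAlgType F) (K : {vspace H}) :
  {vspace H} := (fullv * (K :&: lker counit))%VS.

(* V / U is carried by a complement of U, with quotv_proj as projection.  *)
Definition quotv (F : fieldType) (V : vectType F) (U : {vspace V}) : Type :=
  subvs_of U^C%VS.
HB.instance Definition _ (F : fieldType) (V : vectType F) (U : {vspace V}) :=
  Vector.copy (quotv U) (subvs_of U^C%VS).

Definition quotv_proj (F : fieldType) (V : vectType F) (U : {vspace V}) :
  'Hom(V, quotv U) := linfun (fun v => vsproj U^C (daddv_pi U^C U v) : quotv U).

Definition quotv_val (F : fieldType) (V : vectType F) (U : {vspace V})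
  (x : quotv U) : V := vsval (x : subvs_of _).

Section Quotv.
Variables (F : fieldType) (V : vectType F) (U : {vspace V}).

Lemma quotv_val_linear : linear (@quotv_val F V U).
Proof. by []. Qed.

Lemma quotv_projE v : quotv_val (quotv_proj U v) = daddv_pi U^C U v.
Proof.
rewrite /quotv_val linfunE ?vsprojK ?memv_pi // => c x y.
by rewrite !linearP.
Qed.

Lemma quotv_valK x : quotv_proj U (quotv_val x) = x.
Proof.
apply: val_inj; rewrite -[LHS]/(quotv_val _) quotv_projE daddv_pi_id ?subvsP //.
by rewrite capvC capv_compl.
Qed.

Lemma quotv_projK v : v - quotv_val (quotv_proj U v) \in U.
Proof.
rewrite quotv_projE -{1}[v](@daddv_pi_add _ _ U^C U).
- by rewrite addrC addKr memv_pi.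
- by rewrite capvC capv_compl.
- by rewrite addvC addv_complf memvf.
Qed.

Lemma quotv_proj_lker : lker (quotv_proj U) = U.
Proof.
apply/vspaceP => v; rewrite memv_ker; apply/eqP/idP => [v0|Uv].
  have v00 : quotv_val (0 : quotv U) = 0 := linear0 (@vsval _ _ _).
  by have := quotv_projK v; rewrite v0 v00 subr0.
apply: val_inj; rewrite -[LHS]/(quotv_val _) quotv_projE.
have: daddv_pi U U^C v = v by apply: daddv_pi_id => //; apply: capv_compl.
have := @daddv_pi_add _ _ U^C U v; rewrite capvC capv_compl addvC addv_complf memvf.
move=> /(_ erefl isT) E E'; move: E; rewrite E' => /(canRL (addrK _)) ->.
by rewrite subrr.
Qed.

Lemma quotv_proj_limg : limg (quotv_proj U) = fullv.
Proof.
apply/vspaceP => x; rewrite memvf -[x]quotv_valK; exact: memv_img (memvf _).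
Qed.

Lemma quotv_eq v w : v - w \in U -> quotv_proj U v = quotv_proj U w.
Proof.
rewrite -{1}quotv_proj_lker memv_ker linearB subr_eq0 => /eqP; exact.
Qed.

Lemma quotv_lift (W : lmodType F) (g : V -> W) v : linear g ->
  (forall u, u \in U -> g u = 0) -> g (quotv_val (quotv_proj U v)) = g v.
Proof.
move=> /linear_pack[{}g ->] g0; apply/eqP; rewrite eq_sym -subr_eq0 -linearB.
by rewrite g0 ?quotv_projK.
Qed.

End Quotv.

(* H//K = H/HK^+; the algebra and coalgebra structures are the ones making the
   projection quotv_proj (augv K) a morphism.                                *)
Definition hquot (F : fieldType) (H : hopfAlgType F) (K : {vspace H})
  (nK : normal_hopf_subalg K) : Type := quotv (augv K).
HB.instance Definition _ (F : fieldType) (H : hopfAlgType F) (K : {vspace H})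
  (nK : normal_hopf_subalg K) := Vector.copy (hquot nK) (quotv (augv K)).

Definition hquot_proj (F : fieldType) (H : hopfAlgType F) (K : {vspace H})
  (nK : normal_hopf_subalg K) : 'Hom(H, hquot nK) := quotv_proj (augv K).

Section HopfQuotient.
Variables (F : fieldType) (H : hopfAlgType F) (K : {vspace H}).
Hypothesis nK : normal_hopf_subalg K.
Implicit Types (x y z : hquot nK) (a b g h k : H).
Local Notation L := (hquot nK).
Local Notation pr := (hquot_proj nK).
Let vl (x : L) : H := quotv_val (x : quotv (augv K)).

Let vl_lin : linear vl. Proof. by []. Qed.
Let vlK x : pr (vl x) = x. Proof. exact: quotv_valK. Qed.

Let augvl g h : h \in augv K -> g * h \in augv K.
Proof.
move=> Kh; have /subvP: (fullv * augv K <= augv K)%VS.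
  by rewrite /augv prodvA prodvSl ?subvf.
by apply; rewrite memv_mul ?memvf.
Qed.

Let aug_mem h k : k \in K -> counit k = 0 -> h * k \in augv K.
Proof.
by move=> Kk k0; rewrite memv_mul ?memvf // memv_cap Kk memv_ker k0 eqxx.
Qed.

Let aug_ker (W : vectType F) (f : H -> W) : linear f ->
  (forall h k, k \in K -> counit k = 0 -> f (h * k) = 0) ->
  forall u, u \in augv K -> f u = 0.
Proof.
move=> lf f0 u; have: (augv K <= lker (linfun f))%VS.
  apply/prodvP => h k _; rewrite memv_cap !memv_ker linfunE //.
  by move=> /andP[Kk /eqP/(f0 h _ Kk)->].
by move=> /subvP/[apply]; rewrite memv_ker linfunE // => /eqP.
Qed.

Let counit_aug u : u \in augv K -> counit u = 0.
Proof.
apply: (aug_ker (f := counit)) => [|h k _ k0]; first exact: linearP.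
by rewrite counitM k0 mulr0.
Qed.

Let aug_memr h k : k \in K -> counit k = 0 -> k * h \in augv K.
Proof.
move=> Kk k0.
have -> : k * h = \sw_(a, b <- comult h)
    (a * \sw_(b1, b2 <- comult b) (antipode b1 * k * b2)).
  under [RHS]eq_tlift => a b do rewrite mul_tlift.
  rewrite -(@comult_assoc _ _ _ (fun a b1 b2 => a * (antipode b1 * k * b2)));
    [|move=> *; by lin ..].
  rewrite -[LHS](@counitl_lfun _ _ _ (fun v => k * v)); last by lin.
  apply: eq_tlift => a b; transitivity
      ((\sw_(a1, a2 <- comult a) (a1 * antipode a2)) * (k * b)).
    by rewrite antipoder -scalerAl mul1r.
  by rewrite tlift_mul; apply: eq_tlift => *; rewrite !mulrA.
apply: tlift_mem => a b; apply: aug_mem; first exact: nhs_adr.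
rewrite (linear_tlift (g := counit)); last exact: linearP.
transitivity (\sw_(b1, b2 <- comult b) (0 : F^o)).
  by apply: eq_tlift => *; rewrite !counitM k0 mulr0 mul0r.
by rewrite /tlift big1 // => i _; rewrite big1 // => j _; rewrite scaler0.
Qed.

Let augvr g h : g \in augv K -> g * h \in augv K.
Proof.
move=> Kg; suff: (augv K <= lker (quotv_proj (augv K) \o amulr h))%VS.
  by move=> /subvP/(_ _ Kg); rewrite memv_ker lfunE /= lfunE /= -memv_ker quotv_proj_lker.
apply/prodvP => u k _; rewrite memv_cap !memv_ker => /andP[Kk /eqP k0].
rewrite lfunE /= lfunE /= -memv_ker quotv_proj_lker -mulrA.
by apply: augvl; apply: aug_memr.
Qed.

Let prP a b : a - b \in augv K -> pr a = pr b. Proof. exact: quotv_eq. Qed.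
Let prK a : a - vl (pr a) \in augv K. Proof. exact: quotv_projK. Qed.

Definition hquot_mul x y : L := pr (vl x * vl y).

Let pr_mul a b : hquot_mul (pr a) (pr b) = pr (a * b).
Proof.
apply/esym/prP.
have -> : a * b - vl (pr a) * vl (pr b) =
    a * (b - vl (pr b)) + (a - vl (pr a)) * vl (pr b).
  by rewrite mulrBr mulrBl addrA subrK.
by apply: memvD; [apply: augvl | apply: augvr]; apply: prK.
Qed.

Let pr_surj x : exists a, x = pr a. Proof. by exists (vl x). Qed.

Let mulA : associative hquot_mul.
Proof.
move=> x y z; have [[[a ->] [b ->]] [c ->]] := (pr_surj x, pr_surj y, pr_surj z).
by rewrite !pr_mul mulrA.
Qed.

Let mul1l : left_id (pr 1) hquot_mul.
Proof. by move=> x; have [a ->] := pr_surj x; rewrite pr_mul mul1r. Qed.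

Let mul1r : right_id (pr 1) hquot_mul.
Proof. by move=> x; have [a ->] := pr_surj x; rewrite pr_mul mulr1. Qed.

Let mulDl : left_distributive hquot_mul +%R.
Proof.
move=> x y z; have [[[a ->] [b ->]] [c ->]] := (pr_surj x, pr_surj y, pr_surj z).
by rewrite -linearD !pr_mul mulrDl linearD.
Qed.

Let mulDr : right_distributive hquot_mul +%R.
Proof.
move=> x y z; have [[[a ->] [b ->]] [c ->]] := (pr_surj x, pr_surj y, pr_surj z).
by rewrite -linearD !pr_mul mulrDr linearD.
Qed.

Let one_neq0 : pr 1 != 0 :> L.
Proof.
rewrite -memv_ker [lker _]quotv_proj_lker; apply/negP => /counit_aug/eqP.
by rewrite counit1 oner_eq0.
Qed.

HB.instance Definition _ := GRing.Zmodule_isNzRing.Build L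
  mulA mul1l mul1r mulDl mulDr one_neq0.

Let mulE x y : x * y = hquot_mul x y. Proof. by []. Qed.

Let prZ c a : pr (c *: a) = c *: pr a. Proof. exact: linearZ. Qed.

Let mulZl c x y : c *: (x * y) = (c *: x) * y.
Proof.
have [[a ->] [b ->]] := (pr_surj x, pr_surj y).
by rewrite !mulE pr_mul -!prZ pr_mul scalerAl.
Qed.
HB.instance Definition _ := GRing.Lmodule_isLalgebra.Build F L mulZl.

Let mulZr c x y : c *: (x * y) = x * (c *: y).
Proof.
have [[a ->] [b ->]] := (pr_surj x, pr_surj y).
by rewrite !mulE pr_mul -!prZ pr_mul scalerAr.
Qed.
HB.instance Definition _ := GRing.Lalgebra_isAlgebra.Build F L mulZr.

HB.instance Definition _ := Algebra_isFalgebra.Build F L.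

Lemma hquot_proj1 : pr 1 = 1. Proof. by []. Qed.

Lemma hquot_projM a b : pr (a * b) = pr a * pr b.
Proof. by rewrite -pr_mul. Qed.

Definition hquot_comult : 'Hom(L, tens L L) :=
  linfun (fun x => \sw_(a, b <- comult (vl x)) tns (pr a) (pr b)).
Definition hquot_counit : 'Hom(L, F^o) := linfun (fun x => counit (vl x)).
Definition hquot_antipode : 'End(L) := linfun (fun x => pr (antipode (vl x))).

Let pr_scale h k : k \in K -> pr (h * k) = (counit k : F) *: pr h.
Proof.
move=> Kk; rewrite -linearZ /=; apply: prP.
have -> : h * k - (counit k : F) *: h = h * (k - (counit k : F) *: 1).
  by rewrite mulrBr -scalerAr mulr1.
apply: aug_mem; first by rewrite memvB ?memvZ ?nhs_one.
by rewrite linearB linearZ /= counit1 [_ *: _]mulr1 subrr.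
Qed.

Lemma hquot_comultE h :
  hquot_comult (pr h) = \sw_(a, b <- comult h) tns (pr a) (pr b).
Proof.
rewrite linfunE; last by apply: lin_tlift; apply: lin_lfun.
apply: (quotv_lift (g := fun h => \sw_(a, b <- comult h) tns (pr a) (pr b))).
  by lin.
apply: aug_ker => [|g k Kk k0]; first by lin.
rewrite comultM_lift; last by lin.
transitivity (\sw_(a, b <- comult g) (0 : tens L L)); last first.
  by rewrite /tlift big1 // => i _; rewrite big1 // => j _; rewrite scaler0.
apply: eq_tlift => a b.
transitivity (\sw_(c, d <- comult k)
   ((counit c : F) *: ((counit d : F) *: tns (pr a) (pr b)))).
  apply: (tensv_eq _ _ _ (nhs_comult nK Kk)); [by lin | by lin |].
  move=> u w Ku Kw; rewrite !tliftE; [|by lin|by lin].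
  by rewrite !pr_scale // tnsZl tnsZr.
rewrite (@counitl_lfun _ _ _ (fun d => (counit d : F) *: tns (pr a) (pr b))).
  by rewrite k0 scale0r.
by lin.
Qed.

Lemma hquot_counitE h : hquot_counit (pr h) = counit h.
Proof.
rewrite linfunE; last by apply: lin_lfun.
by apply: (quotv_lift (g := counit)) => //; apply: linearP.
Qed.

Lemma hquot_antipodeE h : hquot_antipode (pr h) = pr (antipode h).
Proof.
rewrite linfunE; last by do 2!apply: lin_lfun.
apply: (quotv_lift (g := fun h => pr (antipode h))); first by lin.
apply: aug_ker => [|g k Kk k0]; first by lin.
apply/eqP; rewrite antipodeM -memv_ker [lker _]quotv_proj_lker.
by apply: aug_memr; rewrite ?counit_antipode ?nhs_antipode.
Qed.

Let comult_lift (U : lmodType F) (f : L -> L -> U) h : bilin f ->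
  tlift f (hquot_comult (pr h)) = \sw_(a, b <- comult h) f (pr a) (pr b).
Proof.
move=> bf; rewrite hquot_comultE (linear_tlift (g := tlift f)).
  by apply: eq_tlift => a b; rewrite tliftE.
exact: tlift_linear.
Qed.

Let L_comultA x :
    \sw_(a, b <- hquot_comult x) \sw_(a1, a2 <- hquot_comult a) tns (tns a1 a2) b =
    \sw_(a, b <- hquot_comult x) \sw_(b1, b2 <- hquot_comult b) tns (tns a b1) b2.
Proof.
have [h ->] := pr_surj x; rewrite !comult_lift; [|by lin|by lin].
transitivity (\sw_(a, b <- comult h) \sw_(a1, a2 <- comult a)
    tns (tns (pr a1) (pr a2)) (pr b)).
  by apply: eq_tlift => a b; rewrite comult_lift //; lin.
rewrite (comult_assoc _ (f := fun a1 a2 b => tns (tns (pr a1) (pr a2)) (pr b)));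
  [|move=> *; by lin ..].
by apply: eq_tlift => a b; rewrite comult_lift //; lin.
Qed.

Let L_counitl x : \sw_(a, b <- hquot_comult x) ((hquot_counit a : F) *: b) = x.
Proof.
have [h ->] := pr_surj x; rewrite comult_lift; last by lin.
under eq_tlift => a b do rewrite hquot_counitE.
by rewrite counitl_lfun //; exact: linearP.
Qed.

Let L_counitr x : \sw_(a, b <- hquot_comult x) ((hquot_counit b : F) *: a) = x.
Proof.
have [h ->] := pr_surj x; rewrite comult_lift; last by lin.
under eq_tlift => a b do rewrite hquot_counitE.
by rewrite counitr_lfun //; exact: linearP.
Qed.

Let L_comult1 : hquot_comult 1 = tns 1 1.
Proof. by rewrite -hquot_proj1 hquot_comultE comult1 tliftE //; lin. Qed.

Let L_comultM x y :
  hquot_comult (x * y) = tmul (hquot_comult x) (hquot_comult y).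
Proof.
have [[g ->] [h ->]] := (pr_surj x, pr_surj y).
rewrite -hquot_projM hquot_comultE comultM_lift; last by lin.
rewrite /tmul comult_lift; last by lin.
apply: eq_tlift => a b; rewrite comult_lift; last by lin.
by apply: eq_tlift => c d; rewrite !hquot_projM.
Qed.

Let L_counit1 : hquot_counit 1 = 1.
Proof. by rewrite -hquot_proj1 hquot_counitE counit1. Qed.

Let L_counitM x y : hquot_counit (x * y) = hquot_counit x * hquot_counit y.
Proof.
have [[g ->] [h ->]] := (pr_surj x, pr_surj y).
by rewrite -hquot_projM !hquot_counitE counitM.
Qed.

Let L_antipodel x :
  \sw_(a, b <- hquot_comult x) (hquot_antipode a * b) = (hquot_counit x : F) *: 1.
Proof.
have [h ->] := pr_surj x; rewrite comult_lift; last by lin.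
rewrite hquot_counitE -hquot_proj1 -prZ -antipodel.
rewrite (linear_tlift (g := pr)); last exact: linearP.
by apply: eq_tlift => a b; rewrite hquot_projM hquot_antipodeE.
Qed.

Let L_antipoder x :
  \sw_(a, b <- hquot_comult x) (a * hquot_antipode b) = (hquot_counit x : F) *: 1.
Proof.
have [h ->] := pr_surj x; rewrite comult_lift; last by lin.
rewrite hquot_counitE -hquot_proj1 -prZ -antipoder.
rewrite (linear_tlift (g := pr)); last exact: linearP.
by apply: eq_tlift => a b; rewrite hquot_projM hquot_antipodeE.
Qed.

HB.instance Definition _ := Falgebra_isHopf.Build F L
  L_comultA L_counitl L_counitr L_comult1 L_comultM L_counit1 L_counitM
  L_antipodel L_antipoder.

End HopfQuotient.

(* The regular left module is completely reducible. *)
Definition semisimple (F : fieldType) (A : falgType F) : Prop :=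
  let left_ideal (U : {vspace A}) := forall a u, u \in U -> a * u \in U in
  forall U : {vspace A}, left_ideal U ->
  exists W : {vspace A},
    [/\ left_ideal W, (U + W)%VS = fullv & (U :&: W)%VS = 0%VS].

(* A finite dimensional left module, given in coordinates: A acts on the
   columns 'cV_hmod_deg by left multiplication.                              *)
Record hmodule (F : fieldType) (A : falgType F) := HModule {
  hmod_deg : nat;
  hmod_act :> 'Hom(A, 'M[F]_hmod_deg);
  hmod_act1 : hmod_act 1 = 1%:M;
  hmod_actM : forall a b, hmod_act (a * b) = hmod_act a *m hmod_act b
}.

Definition simple_hmodule (F : fieldType) (A : falgType F) (M : hmodule A) :
    Prop :=
  (0 < hmod_deg M)%N /\
  forall U : {vspace 'cV[F]_(hmod_deg M)},
    (forall a v, v \in U -> M a *m v \in U) -> U = 0%VS \/ U = fullv.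

Section Characters.
Variables (F : fieldType) (H : hopfAlgType F).

Definition hmod_char (M : hmodule H) : dual H :=
  linfun (fun h => \tr (M h) : F^o).

Definition hmod_coef (M : hmodule H) (i j : 'I_(hmod_deg M)) : dual H :=
  linfun (fun h => M h i j : F^o).

Lemma hmod_charE M h : hmod_char M h = \tr (M h).
Proof. by rewrite linfunE // => c x y; rewrite !linearP. Qed.

Lemma hmod_coefE M i j h : @hmod_coef M i j h = M h i j.
Proof. by rewrite linfunE // => c x y; rewrite linearP !mxE. Qed.

Definition coefv (M : hmodule H) : {vspace dual H} :=
  <<[seq hmod_coef i j | i <- enum 'I_(hmod_deg M), j <- enum 'I_(hmod_deg M)]>>%VS.

Record Irr := MkIrr {
  irr_char : dual H;
  irr_charP : exists M : hmodule H, simple_hmodule M /\ hmod_char M = irr_char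
}.

(* A simple module affording chi (it is unique up to isomorphism). *)
Definition irr_mod (chi : Irr) : hmodule H := projT1 (cid (irr_charP chi)).

Lemma irr_mod_simple chi : simple_hmodule (irr_mod chi).
Proof. by rewrite /irr_mod; case: cid => M []. Qed.

Lemma irr_mod_char chi : hmod_char (irr_mod chi) = irr_char chi.
Proof. by rewrite /irr_mod; case: cid => M []. Qed.

Definition irr_coalg (chi : Irr) : {vspace dual H} := coefv (irr_mod chi).

Definition res_char (K : {vspace H}) (f : dual H) : 'Hom(subvs_of K, F^o) :=
  (f \o linfun vsval)%VF.

Lemma res_charE K f (x : subvs_of K) : res_char K f x = f (vsval x).
Proof. by rewrite lfunE /= lfunE. Qed.

Section Relation.
Variables (K : {vspace H}) (nK : normal_hopf_subalg K).

Definition hquot_dual (f : dual (hquot nK)) : dual H := (f \o hquot_proj nK)%VF.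

(* L^* as a subspace of H^* *)
Definition hquot_dualv : {vspace dual H} := limg (linfun hquot_dual).

Lemma hquot_dual_linear : linear hquot_dual.
Proof. by move=> c f g; rewrite /hquot_dual comp_lfunDl comp_lfunZl. Qed.

Definition irr_sim (chi mu : Irr) : Prop :=
  (irr_coalg chi <= hquot_dualv * irr_coalg mu)%VS.

End Relation.

End Characters.

(* Main.v *)
(** Call two H-modules linked when there is a nonzero K-linear map between them.
    A left integral x of K with counit 1 turns every linear map phi into the
    K-linear map x_1 phi S(x_2); such an integral exists because K has a nonzero
    left integral (a trace over K) and, K being normal, integrals killed by the
    counit would generate a left ideal of H with square zero.  With x at hand,
    linkedness is symmetric, is implied by proportionality of the restricted
    characters (the trace of the averaging idempotent is its rank), and is
    equivalent to the relation C_chi <= L^* C_mu, because for a K-linear Psi the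
    coefficients of h_1 Psi S(h_2) lie in L^*.

    If M is simple, the composition factors of L (x) M are exactly the simple
    modules linked to M, and (L (x) M)|_K is a multiple of M|_K.  So
    M |-> chi_M(k) / chi_M(1), for k in K, is a harmonic function on the finite
    graph of linked simple modules, hence it agrees on linked modules. *)

Require Import Defs.
From mathcomp Require Import all_boot all_order all_algebra all_field.
From mathcomp Require Import boolp reals complex mxtens.

Set Implicit Arguments.
Unset Strict Implicit.
Unset Printing Implicit Defensive.

Import GRing.Theory.
Local Open Scope ring_scope.

(** * Linearity of matrix and tensor expressions *)

Lemma lin_mulmxl (F : fieldType) (L : lmodType F) m n p (A : 'M[F]_(m, n))
    (g : L -> 'M[F]_(n, p)) : linear g -> linear (fun x => A *m g x).
Proof. by move=> lg c x y; rewrite lg linearP. Qed.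

Lemma lin_mulmxr (F : fieldType) (L : lmodType F) m n p (A : 'M[F]_(n, p))
    (g : L -> 'M[F]_(m, n)) : linear g -> linear (fun x => g x *m A).
Proof. by move=> lg c x y; rewrite lg mulmxDl scalemxAl. Qed.

Lemma lin_entry (F : fieldType) (L : lmodType F) m n i j
    (g : L -> 'M[F]_(m, n)) : linear g -> linear (fun x => g x i j : F^o).
Proof. by move=> lg c x y; rewrite lg !mxE. Qed.

Lemma lin_mxtrace (F : fieldType) (L : lmodType F) n
    (g : L -> 'M[F]_n) : linear g -> linear (fun x => \tr (g x) : F^o).
Proof. by move=> lg c x y; rewrite lg linearP. Qed.

Lemma lin_trmx (F : fieldType) (L : lmodType F) m n
    (g : L -> 'M[F]_(m, n)) : linear g -> linear (fun x => (g x)^T).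
Proof. by move=> lg c x y; rewrite lg linearP. Qed.

Lemma lin_tensmxl (F : fieldType) (L : lmodType F) m n p q (A : 'M[F]_(p, q))
    (g : L -> 'M[F]_(m, n)) : linear g -> linear (fun x => tensmx (g x) A).
Proof. by move=> lg c x y; apply/matrixP=> i j; rewrite lg !mxE mulrDl mulrA. Qed.

Lemma lin_tensmxr (F : fieldType) (L : lmodType F) m n p q (A : 'M[F]_(p, q))
    (g : L -> 'M[F]_(m, n)) : linear g -> linear (fun x => tensmx A (g x)).
Proof. by move=> lg c x y; apply/matrixP=> i j; rewrite lg !mxE mulrDr mulrCA. Qed.

Lemma lin_coord (F : fieldType) (L : lmodType F) (V : vectType F) n
    (e : n.-tuple V) i (g : L -> V) :
  linear g -> linear (fun x => coord e i (g x) : F^o).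
Proof. by move=> lg c x y; rewrite lg linearP. Qed.

Lemma lin_sum (F : fieldType) (L M : lmodType F) (I : finType) (g : I -> L -> M) :
  (forall i, linear (g i)) -> linear (fun x => \sum_i g i x).
Proof.
move=> lg c x y; rewrite scaler_sumr -big_split.
by apply: eq_bigr => i _; rewrite lg.
Qed.

Lemma lin_comp (F : fieldType) (L M N : lmodType F) (h : M -> N) (g : L -> M) :
  linear h -> linear g -> linear (fun x => h (g x)).
Proof. by move=> lh lg c x y; rewrite lg lh. Qed.

Ltac mlin :=
  match goal with
  | |- bilin _ => split=> ? /=; mlin
  | |- linear _ => first
     [ exact: lin_id | assumption
     | match goal with lh : linear ?h |- _ => apply: (lin_comp lh); mlin end
     | match goal with bf : bilin ?f |- _ =>
         first [apply: (lin_comp (bf.1 _)) | apply: (lin_comp (bf.2 _))]; mlin end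
     | apply: lin_mul_reg; mlin | apply: lin_mul_regr; mlin
     | apply: lin_mull; mlin | apply: lin_mulr; mlin
     | apply: lin_mulmxl; mlin | apply: lin_mulmxr; mlin
     | apply: lin_tensmxl; mlin | apply: lin_tensmxr; mlin
     | apply: lin_trmx; mlin | apply: lin_coord; mlin
     | apply: lin_mxtrace; mlin | apply: lin_entry; mlin
     | apply: lin_lfun; mlin
     | apply: lin_scaler; mlin | apply: lin_scalel; mlin
     | apply: lin_tnsl; mlin | apply: lin_tnsr; mlin
     | apply: lin_sum => ? /=; mlin
     | apply: lin_tlift; mlin
     | apply: lin_tlift_fun => ? ? /=; mlin ]
  end.

Lemma sum_tlift (F : fieldType) (V W : vectType F) (U : lmodType F)
    (I : finType) (f : I -> V -> W -> U) t :
  \sum_i tlift (f i) t = \sw_(a, b <- t) \sum_i f i a b.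
Proof.
rewrite /tlift exchange_big; apply: eq_bigr => i _; rewrite exchange_big.
by apply: eq_bigr => j _; rewrite scaler_sumr.
Qed.

Lemma tlift0 (F : fieldType) (V W : vectType F) (U : lmodType F) (t : tens V W) :
  \sw_(a, b <- t) (0 : U) = 0.
Proof. by rewrite /tlift big1 // => i _; rewrite big1 // => j _; rewrite scaler0. Qed.

(** The expansion behind [tlift] uses bases of all of [V] and [W]; bilinearity is what allows the
    legs of [t] to be taken in [A] and [B], typically both in [K] for the coproduct of an element of
    [K]. *)
Lemma eq_tlift_in (F : fieldType) (V W X : vectType F) (A : {vspace V})
    (B : {vspace W}) (f g : V -> W -> X) t : t \in tensv A B ->
  bilin f -> bilin g -> (forall u w, u \in A -> w \in B -> f u w = g u w) ->
  tlift f t = tlift g t.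
Proof.
move=> tAB bf bg fg; apply: (tensv_eq _ _ _ tAB); try exact: tlift_linear.
by move=> u w Au Bw; rewrite !tliftE // fg.
Qed.

Lemma tlift_mem_in (F : fieldType) (V W X : vectType F) (A : {vspace V})
    (B : {vspace W}) (U : {vspace X}) (f : V -> W -> X) t : t \in tensv A B ->
  bilin f -> (forall u w, u \in A -> w \in B -> f u w \in U) ->
  tlift f t \in U.
Proof.
move=> tAB [bf1 bf2] fU.
(* Modulo [U], membership becomes an equation within reach of [eq_tlift_in]. *)
suff E : quotv_proj U (tlift f t) = 0 by rewrite -(quotv_proj_lker U) memv_ker E.
rewrite (linear_tlift (g := quotv_proj U)); last exact: linearP.
rewrite -(@tlift0 _ V W _ t); apply: (eq_tlift_in tAB).
- by split=> ?; apply: lin_lfun.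
- by split=> ? c x y; rewrite scaler0 addr0.
- by move=> u w Au Bw; apply/eqP; rewrite -memv_ker quotv_proj_lker fU.
Qed.

(** * Left integrals of a normal Hopf subalgebra *)

Section Integral.
Variables (F : fieldType) (H : hopfAlgType F) (K : {vspace H}).
Hypothesis nK : normal_hopf_subalg K.
Implicit Types (k x y : H) (g : H -> F^o).

Definition left_integral x := x \in K /\ forall k, k \in K -> k * x = (counit k : F) *: x.

Let Z g y : H := \sw_(a, b <- comult y) ((g (antipode (antipode b)) : F) *: a).

Let Z_lin g : linear g -> linear (Z g).
Proof. by move=> lg; apply: lin_tlift; mlin. Qed.

(** The right side is [k_1 y_1] weighted by [g(S(k_3) S^2(k_2) S^2(y_2))], and
    [S(k_3) S^2(k_2) = S(S(k_2) k_3)] collapses by the antipode axiom. *)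
Let mul_Z k y g : linear g ->
  k * Z g y = \sw_(k1, k2 <- comult k) Z (fun c => g (antipode k2 * c)) (k1 * y).
Proof.
move=> lg.
pose f (k1 k2 k3 : H) := \sw_(a, b <- comult y)
  ((g (antipode k3 * (antipode (antipode (k2 * b)))) : F) *: (k1 * a)).
transitivity (\sw_(k1, k2 <- comult k) \sw_(k21, k22 <- comult k2) f k1 k21 k22).
  rewrite -{1}[k]counitr tlift_mul; apply: eq_tlift => k1 k2.
  rewrite /f exchange_tlift /Z mul_tlift; apply: eq_tlift => a b.
  transitivity ((g (antipode (\sw_(q, r <- comult k2) (antipode q * r))
                    * antipode (antipode b)) : F) *: (k1 * a)).
    rewrite antipodel linearZ /= antipode1 -[in RHS]scalerAl mul1r.
    have [g' ->] := linear_pack lg; rewrite linearZ /= -scalerAr -scalerAl.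
    by rewrite scalerA mulrC.
  rewrite (linear_tlift (g := fun v => (g (antipode v * antipode (antipode b)) : F)
     *: (k1 * a))); last by mlin.
  by apply: eq_tlift => q r; rewrite !antipodeM mulrA.
rewrite -comult_assoc /f; [|move=> *; mlin ..].
apply: eq_tlift => k1 k2; rewrite /Z comultM_lift //; by mlin.
Qed.

Let e := vbasis K.

Let e_memS c x : c \in K -> x \in K -> antipode (antipode c) * x \in K.
Proof. by move=> Kc Kx; rewrite (nhs_mul nK) // !(nhs_antipode nK). Qed.

(* The Larson-Sweedler projection onto the coinvariants of the Hopf module K:
   theta (Lam x) is the trace of y |-> theta(y_1) S^2(y_2) x on K.           *)
Let Lam x : H := \sum_(l < \dim K) Z (fun c => coord e l (c * x) : F^o) e`_l.

Let coordl_lin l x : linear (fun c : H => coord e l (c * x) : F^o).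
Proof. by mlin. Qed.

(* Cyclicity of the trace over K. *)
Let trace_swap x u w : x \in K -> u \in K -> w \in K ->
  \sum_(l < \dim K) Z (fun c => coord e l (w * c * x) : F^o) (u * e`_l) =
  \sum_(l < \dim K) Z (fun c => coord e l (c * x) : F^o) (u * (w * e`_l)).
Proof.
move=> Kx Ku Kw.
have Ke (l : 'I_(\dim K)) : e`_l \in K by rewrite vbasis_mem ?mem_nth ?size_tuple.
transitivity (\sum_(l < \dim K) \sum_(m < \dim K) coord e l (w * e`_m) *:
    Z (fun c => coord e m (c * x) : F^o) (u * e`_l)).
  apply: eq_bigr => l _; rewrite /Z.
  transitivity (\sw_(a, b <- comult (u * e`_l)) (\sum_(m < \dim K)
     coord e l (w * e`_m) *: ((coord e m (antipode (antipode b) * x) : F^o) *: a))).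
    apply: (eq_tlift_in (nhs_comult nK (nhs_mul nK Ku (Ke l)))); [by mlin|by mlin|].
    move=> a b Ka Kb.
    rewrite -mulrA {1}(coord_vbasis (e_memS Kb Kx)) mulr_sumr linear_sum scaler_suml.
    by apply: eq_bigr => m _; rewrite -scalerAr linearZ /= scalerA mulrC.
  by rewrite -sum_tlift; apply: eq_bigr => m _; rewrite scale_tlift.
rewrite exchange_big; apply: eq_bigr => m _ /=.
have [Zm DZ] := linear_pack (Z_lin (coordl_lin m x)).
rewrite DZ [in RHS](coord_vbasis (nhs_mul nK Kw (Ke m))) mulr_sumr linear_sum.
by apply: eq_bigr => l _; rewrite -scalerAr linearZ.
Qed.

(** By [mul_Z], multiplying by [k] inserts [S(k_2)] into the functional; [trace_swap] moves it to
    the argument, where [k_1 S(k_2)] becomes the counit of [k]. *)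
Let Lam_integral x : x \in K -> left_integral (Lam x).
Proof.
move=> Kx; have Ke (l : 'I_(\dim K)) : e`_l \in K by rewrite vbasis_mem ?mem_nth ?size_tuple.
split=> [|k Kk].
  apply: memv_suml => l _; apply: (tlift_mem_in (nhs_comult nK (Ke l))).
    by mlin.
  by move=> a b Ka Kb; rewrite memvZ.
rewrite /Lam mulr_sumr.
transitivity (\sw_(k1, k2 <- comult k) \sum_(l < \dim K)
    Z (fun c => coord e l (antipode k2 * c * x) : F^o) (k1 * e`_l)).
  by rewrite -sum_tlift; apply: eq_bigr => l _; rewrite mul_Z.
transitivity (\sw_(k1, k2 <- comult k) \sum_(l < \dim K)
    Z (fun c => coord e l (c * x) : F^o) (k1 * (antipode k2 * e`_l))).
  apply: (eq_tlift_in (nhs_comult nK Kk)); [rewrite /Z; by mlin|rewrite /Z; by mlin|].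
  by move=> u w Ku Kw; rewrite trace_swap // (nhs_antipode nK).
rewrite -sum_tlift scaler_sumr; apply: eq_bigr => l _.
have [Zl DZ] := linear_pack (Z_lin (coordl_lin l x)).
rewrite DZ -linearZ /= -[e`_l in RHS]mul1r scalerAl -antipoder tlift_mul.
rewrite (linear_tlift (g := Zl)); last exact: linearP.
by apply: eq_tlift => a b; rewrite mulrA.
Qed.

(** Summing over [j] rebuilds [S(q)] from its coordinates. What remains is [e_l^*(S(q S(b))) p] over
    the double coproduct of [e_l], which collapses to [e_l^*(1) e_l]. Hence the [Lam e_j] cannot all
    vanish. *)
Let Lam_sum :
  \sum_(j < \dim K) \sw_(p, q <- comult (Lam e`_j)) ((coord e j (antipode q) : F) *: p) = 1.
Proof.
have Ke (l : 'I_(\dim K)) : e`_l \in K by rewrite vbasis_mem ?mem_nth ?size_tuple.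
transitivity (\sum_(l < \dim K) \sw_(a, b <- comult e`_l) \sw_(p, q <- comult a)
   ((coord e l (antipode (q * antipode b)) : F) *: p)).
  transitivity (\sum_(l < \dim K) \sum_(j < \dim K) \sw_(a, b <- comult e`_l)
     ((coord e l (antipode (antipode b) * e`_j) : F) *:
       \sw_(p, q <- comult a) ((coord e j (antipode q) : F) *: p))).
    rewrite [RHS]exchange_big; apply: eq_bigr => j _ /=.
    pose G v := \sw_(p, q <- comult v) ((coord e j (antipode q) : F) *: p).
    have lG : linear G by rewrite /G; mlin.
    rewrite -/(G _); have [G' DG] := linear_pack lG.
    rewrite DG /Lam linear_sum; apply: eq_bigr => l _.
    rewrite (linear_tlift (g := G')); last exact: linearP.
    by apply: eq_tlift => a b; rewrite linearZ -DG.
  apply: eq_bigr => l _; rewrite sum_tlift.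
  apply: (eq_tlift_in (nhs_comult nK (Ke l))); [by mlin|by mlin|].
  move=> a b Ka Kb; under eq_bigr do rewrite scale_tlift.
  rewrite sum_tlift; apply: (eq_tlift_in (nhs_comult nK Ka)); [by mlin|by mlin|].
  move=> p q Kp Kq; rewrite antipodeM.
  rewrite {2}(coord_vbasis (nhs_antipode nK Kq)) mulr_sumr linear_sum scaler_suml.
  by apply: eq_bigr => j _; rewrite -scalerAr [in RHS]linearZ /= scalerA mulrC.
transitivity (\sum_(l < \dim K) coord e l 1 *: e`_l); last first.
  exact/esym/(coord_vbasis (nhs_one nK)).
apply: eq_bigr => l _; rewrite (@comult_assoc _ _ _ (fun p q b =>
  (coord e l (antipode (q * antipode b)) : F) *: p)); [|move=> *; mlin ..].
rewrite -{2}[e`_l]counitr scale_tlift; apply: eq_tlift => a b.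
transitivity ((coord e l (antipode (\sw_(p, q <- comult b) (p * antipode q))) : F) *: a).
  rewrite (linear_tlift (g := fun v => (coord e l (antipode v) : F) *: a)) //.
  by mlin.
by rewrite antipoder linearZ /= antipode1 linearZ /= scalerA mulrC.
Qed.

Lemma left_integral_exists : exists2 x, left_integral x & x != 0.
Proof.
have Ke (l : 'I_(\dim K)) : e`_l \in K by rewrite vbasis_mem ?mem_nth ?size_tuple.
case: (pselect (exists j : 'I_(\dim K), Lam e`_j != 0)) => [[j nz]|none].
  by exists (Lam e`_j) => //; apply: Lam_integral.
have /eqP := Lam_sum; rewrite big1 => [|j _]; first by rewrite eq_sym oner_eq0.
case: (eqVneq (Lam e`_j) 0) => [->|nz]; last by case: none; exists j.
by rewrite !linear0.
Qed.

(** With [ad] the left adjoint action on [k], [k S(a) = S(a_1) ad(a_2)]. By normality [ad(a_2)] lies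
    in [K], so it acts on [x] through its counit, the product of those of [a_2] and [k]. *)
Lemma left_integral_adr h x : left_integral x ->
  left_integral (\sw_(a, b <- comult h) (antipode a * x * b)).
Proof.
case=> Kx intx; split=> [|k Kk]; first exact: (nhs_adr nK).
rewrite mul_tlift scale_tlift; apply: eq_tlift => a b.
pose ad v := \sw_(p, q <- comult v) (p * k * antipode q).
have cad v : counit (ad v) = counit v * counit k.
  rewrite (linear_tlift (g := counit)); last exact: linearP.
  under eq_tlift => p q do rewrite !counitM counit_antipode mulrC.
  by rewrite (@counitr_lfun _ _ _ (fun p => counit p * counit k : F^o)) //; mlin.
have adx v : ad v * x = (counit v * counit k : F) *: x.
  by rewrite intx ?(nhs_adl nK) // cad.
have kS : k * antipode a = \sw_(a1, a2 <- comult a) (antipode a1 * ad a2).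
  under [RHS]eq_tlift => a1 a2 do rewrite mul_tlift.
  rewrite -(@comult_assoc _ _ _ (fun a1 p q => antipode a1 * (p * k * antipode q)));
    [|move=> *; mlin ..].
  rewrite -[LHS](@counitl_lfun _ _ _ (fun v => k * antipode v)); last by mlin.
  apply: eq_tlift => u v; rewrite -[k in LHS]mul1r -mulrA scalerAl -antipodel tlift_mul.
  by apply: eq_tlift => p q; rewrite !mulrA.
rewrite !mulrA kS tlift_mul scalerAl; congr (_ * _).
transitivity (\sw_(a1, a2 <- comult a)
    ((counit a2 : F) *: ((counit k : F) *: (antipode a1 * x)))).
  by apply: eq_tlift => a1 a2; rewrite -mulrA adx scalerA -scalerAr.
rewrite (@counitr_lfun _ _ _ (fun a1 => (counit k : F) *: (antipode a1 * x))) //.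
by mlin.
Qed.

(* If the counit killed every left integral of K, the left ideal generated by
   a nonzero one would have square zero.                                      *)
Lemma normalized_integral : semisimple H ->
  exists2 x, left_integral x & counit x = 1.
Proof.
move=> ssH; have [x intx nzx] := left_integral_exists.
case: (pselect (exists2 y, left_integral y & counit y != 0)) => [[y [Ky inty] nzy]|none].
  exists ((counit y : F)^-1 *: y); last by rewrite linearZ /= [_ *: _]mulVf.
  by split=> [|k Kk]; rewrite ?memvZ // -scalerAr inty // !scalerA mulrC.
have int0 y : left_integral y -> y * x = 0.
  move=> inty; rewrite intx.2; last by case: inty.
  case: (eqVneq (counit y) 0) => [->|nzy]; first by rewrite scale0r.
  by case: none; exists y.
(* [x h = h_1 (S(h_2) x h_3)], and the bracket is again a left integral, so [int0] applies. *)
have xhx h : x * h * x = 0.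
  have -> : x * h = \sw_(a, b <- comult h)
      (a * \sw_(b1, b2 <- comult b) (antipode b1 * x * b2)).
    under [RHS]eq_tlift => a b do rewrite mul_tlift.
    rewrite -(@comult_assoc _ _ _ (fun a b1 b2 => a * (antipode b1 * x * b2)));
      [|move=> *; mlin ..].
    rewrite -[LHS](@counitl_lfun _ _ _ (fun v => x * v)); last by mlin.
    apply: eq_tlift => a b; rewrite -[x in LHS]mul1r -mulrA scalerAl -antipoder tlift_mul.
    by apply: eq_tlift => p q; rewrite !mulrA.
  rewrite tlift_mul -[RHS](@tlift0 _ H H _ (comult h)).
  by apply: eq_tlift => a b; rewrite -mulrA int0 ?mulr0 //; apply: left_integral_adr.
pose U := limg (linfun (fun h => h * x)).
have UP u : u \in U -> exists h, u = h * x.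
  move=> /memv_imgP[h _ ->]; exists h; rewrite linfunE //; by mlin.
have hxU h : h * x \in U.
  have -> : h * x = linfun (fun h => h * x) h by rewrite linfunE //; mlin.
  by rewrite memv_img ?memvf.
have [|W [idW UW0 capUW]] := ssH U.
  by move=> a u /UP[h ->]; rewrite mulrA.
(* Write [1 = h x + w] along [U + W]; then [x = x h x + x w = x w] lies in both [U] and [W]. *)
have /memv_addP[j /UP[h Dj] [w Ww D1]] : 1 \in (U + W)%VS by rewrite UW0 memvf.
have: x \in (U :&: W)%VS.
  rewrite memv_cap -{1}[x]mul1r hxU /= -[x]mulr1 D1 mulrDr Dj mulrA xhx add0r.
  exact: idW.
by rewrite capUW memv0 (negPf nzx).
Qed.

End Integral.

(** * Averaging over a normalised integral *)

Lemma mul_delta_mulmx (F : fieldType) m n p q (A : 'M[F]_(m, n))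
    (B : 'M[F]_(p, q)) j l i r :
  (A *m delta_mx j l *m B) i r = A i j * B l r.
Proof.
rewrite -(mul_delta_mx (0 : 'I_1)) mulmxA -colE -mulmxA -rowE mxE big_ord1 !mxE.
by [].
Qed.

Section Averaging.
Variables (F : fieldType) (H : hopfAlgType F) (K : {vspace H}).
Hypothesis nK : normal_hopf_subalg K.
Implicit Types M N : hmodule H.

Definition klinear M N (Psi : 'M[F]_(hmod_deg N, hmod_deg M)) :=
  forall k, k \in K -> N k *m Psi = Psi *m M k.

Definition linked M N :=
  exists2 Psi : 'M[F]_(hmod_deg N, hmod_deg M), klinear Psi & Psi != 0.

Variable x : H.
Hypotheses (intx : left_integral K x) (counitx : counit x = 1).

Let comultx : comult x \in tensv K K. Proof. exact: (nhs_comult nK intx.1). Qed.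

Definition avg M N (phi : 'M[F]_(hmod_deg N, hmod_deg M)) :
    'M[F]_(hmod_deg N, hmod_deg M) :=
  \sw_(a, b <- comult x) (N a *m phi *m M (antipode b)).

(** The Casimir property of the integral: [f(k x_1, S(x_2)) = f(k_1 x_1, S(k_2 x_2) k_3)], after
    which [k_1 x] is the counit of [k_1] times [x]. *)
Let integral_swap (U : vectType F) (f : H -> H -> U) k : bilin f -> k \in K ->
  \sw_(a, b <- comult x) f (k * a) (antipode b) =
  \sw_(a, b <- comult x) f a (antipode b * k).
Proof.
move=> bf Kk.
transitivity (\sw_(k1, k2 <- comult k)
    \sw_(a, b <- comult (k1 * x)) f a (antipode b * k2)); last first.
  transitivity (\sw_(k1, k2 <- comult k) ((counit k1 : F) *:
      \sw_(a, b <- comult x) f a (antipode b * k2))).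
    apply: (eq_tlift_in (nhs_comult nK Kk)); [by mlin|by mlin|].
    by move=> u w Ku Kw; rewrite intx.2 // !linearZ.
  rewrite (@counitl_lfun _ _ _ (fun k2 => \sw_(a, b <- comult x) f a (antipode b * k2))) //.
  by mlin.
transitivity (\sw_(k1, k2 <- comult k) \sw_(p, q <- comult k1)
    \sw_(a, b <- comult x) f (p * a) (antipode (q * b) * k2)); last first.
  by apply: eq_tlift => k1 k2; rewrite comultM_lift //; mlin.
rewrite (@comult_assoc _ _ _ (fun p q k2 => \sw_(a, b <- comult x)
   f (p * a) (antipode (q * b) * k2))); [|move=> *; mlin ..].
rewrite -[LHS](@counitr_lfun _ _ _ (fun v => \sw_(a, b <- comult x) f (v * a) (antipode b)));
  last by mlin.
apply: eq_tlift => p k'; rewrite scale_tlift exchange_tlift; apply: eq_tlift => a b.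
have [f' Df] := linear_pack (bf.2 (p * a)).
rewrite Df -linearZ /= -[antipode b in LHS]mulr1 scalerAr -antipodel mul_tlift.
rewrite (linear_tlift (g := f')); last exact: linearP.
by apply: eq_tlift => q r; rewrite antipodeM mulrA.
Qed.

Lemma avg_klinear M N phi : klinear (@avg M N phi).
Proof.
move=> k Kk; rewrite (linear_tlift (g := fun A => N k *m A)); last by mlin.
rewrite (linear_tlift (g := fun A => A *m M k)); last by mlin.
transitivity (\sw_(a, b <- comult x) (N (k * a) *m phi *m M (antipode b))).
  by apply: eq_tlift => a b; rewrite hmod_actM !mulmxA.
rewrite (integral_swap (f := fun a b => N a *m phi *m M b)) //; last by mlin.
by apply: eq_tlift => a b; rewrite hmod_actM !mulmxA.
Qed.

Lemma avg_comp M1 M2 N1 N2 (A : 'M[F]_(hmod_deg N2, hmod_deg N1))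
    (B : 'M[F]_(hmod_deg M2, hmod_deg M1)) phi : klinear A -> klinear B ->
  avg (A *m phi *m B) = A *m avg phi *m B.
Proof.
move=> kA kB; rewrite (linear_tlift (g := fun X => A *m X *m B)); last by mlin.
apply: (eq_tlift_in comultx); [by mlin|by mlin|] => a b Ka Kb.
by rewrite !mulmxA kA // -2!mulmxA -kB ?(nhs_antipode nK) // !mulmxA.
Qed.

Lemma klinear1 M : @klinear M M 1%:M.
Proof. by move=> k _; rewrite mul1mx mulmx1. Qed.

Lemma avg1 M : @avg M M 1%:M = 1%:M.
Proof.
transitivity (M (\sw_(a, b <- comult x) (a * antipode b))).
  rewrite (linear_tlift (g := M)); last exact: linearP.
  by apply: eq_tlift => a b; rewrite mulmx1 hmod_actM.
by rewrite antipoder counitx scale1r hmod_act1.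
Qed.

Lemma avg_klin_id M N phi : @klinear M N phi -> avg phi = phi.
Proof.
move=> kphi; have := avg_comp 1%:M kphi (@klinear1 M).
by rewrite avg1 !mulmx1.
Qed.

(** A generalised inverse [P] satisfies [Psi P Psi = Psi]. Averaging keeps the outer factors, so
    [Psi avg(P) Psi = Psi] and [avg(P)] is a nonzero map backwards. *)
Lemma linked_sym M N : linked M N -> linked N M.
Proof.
case=> Psi kPsi nz; exists (@avg N M (pinvmx Psi)); first exact: avg_klinear.
have E : Psi *m avg (pinvmx Psi) *m Psi = Psi.
  by rewrite -avg_comp // mulmxKpV // avg_klin_id.
by apply: contraNneq nz => E0; rewrite -E E0 mulmx0 mul0mx.
Qed.

(** Schur orthogonality: the average of a matrix unit is [K]-linear, hence zero, and the sum is one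
    of its entries. *)
Lemma unlinked_coef M N : ~ linked M N -> forall i j p q,
  \sw_(a, b <- comult x) (N a i j * M (antipode b) p q : F^o) = 0.
Proof.
move=> nadj i j p q.
have E : @avg M N (delta_mx j p) = 0.
  case: (eqVneq (@avg M N (delta_mx j p)) 0) => // nz.
  by case: nadj; exists (@avg M N (delta_mx j p)) => //; apply: avg_klinear.
transitivity ((@avg M N (delta_mx j p)) i q); last by rewrite E mxE.
rewrite (linear_tlift (g := fun A : 'M[F]_(_, _) => A i q : F^o)); last by mlin.
by apply: eq_tlift => a b; rewrite mul_delta_mulmx.
Qed.

(** The sums with [j = p] and [i = q = 0] add up to a diagonal entry of the averaged identity, which
    is 1. *)
Lemma coef_neq0 M : (0 < hmod_deg M)%N -> ~ forall i j p q,
  \sw_(a, b <- comult x) (M a i j * M (antipode b) p q : F^o) = 0.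
Proof.
case: M => [[|n] M M1 MM] //= _ E.
pose M' := HModule M1 MM.
have := congr1 (fun A : 'M[F]_n.+1 => A 0 0) (avg1 M').
rewrite mxE eqxx.
rewrite (linear_tlift (g := fun A : 'M[F]_(_, _) => A 0 0 : F^o)); last by mlin.
under eq_tlift => a b do rewrite mulmx1 mxE.
by rewrite -sum_tlift big1 => [/eqP|j _]; [rewrite eq_sym oner_eq0 | apply: E].
Qed.

End Averaging.

(** * Linked modules and the relation on Irr(H) *)

Lemma hmod_coef_mem (F : fieldType) (H : hopfAlgType F) (M : hmodule H) i j :
  @hmod_coef _ _ M i j \in coefv M.
Proof.
apply: memv_span; apply/allpairsP; exists (i, j).
by split; rewrite /= ?mem_enum.
Qed.

Lemma coefv_subP (F : fieldType) (H : hopfAlgType F) (M : hmodule H)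
    (U : {vspace dual H}) :
  (forall i j, @hmod_coef _ _ M i j \in U) -> (coefv M <= U)%VS.
Proof. by move=> cU; apply/span_subvP => _ /allpairsP[[i j] [_ _ ->]]. Qed.

Section Similarity.
Variables (F : fieldType) (H : hopfAlgType F) (K : {vspace H}).
Hypothesis nK : normal_hopf_subalg K.
Implicit Types M N : hmodule H.
Local Notation pr := (hquot_proj nK).

Lemma hquot_proj_mulK h k : k \in K -> pr (h * k) = (counit k : F) *: pr h.
Proof.
move=> Kk; rewrite -linearZ /=; apply: quotv_eq.
have -> : h * k - (counit k : F) *: h = h * (k - (counit k : F) *: 1).
  by rewrite mulrBr -scalerAr mulr1.
rewrite memv_mul ?memvf // memv_cap memvB ?memvZ ?(nhs_one nK) //=.
by rewrite memv_ker linearB linearZ /= counit1 [_ *: _]mulr1 subrr.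
Qed.

Lemma hquot_projK k : k \in K -> pr k = (counit k : F) *: 1.
Proof. by move=> Kk; rewrite -[k in LHS]mul1r hquot_proj_mulK. Qed.

Lemma hquot_proj_lift (W : vectType F) (f : H -> W) h : linear f ->
  (forall a k, k \in K -> f (a * k) = (counit k : F) *: f a) ->
  f (quotv_val (pr h)) = f h.
Proof.
move=> lf fK; apply: quotv_lift => // u.
have: (augv K <= lker (linfun f))%VS.
  apply/prodvP => a k _; rewrite memv_cap !memv_ker linfunE //.
  by move=> /andP[Kk /eqP k0]; rewrite fK // k0 scale0r.
by move=> /subvP/[apply]; rewrite memv_ker linfunE // => /eqP.
Qed.

Lemma hquot_dualvP (f : dual H) :
  (forall a k, k \in K -> f (a * k) = counit k * f a) -> f \in hquot_dualv nK.
Proof.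
move=> fK; pose g : dual (hquot nK) := linfun (fun y : hquot nK => f (quotv_val y) : F^o).
have -> : f = linfun (@hquot_dual _ _ _ nK) g.
  rewrite linfunE; last exact: hquot_dual_linear.
  apply/lfunP => h; rewrite lfunE /= linfunE; last by move=> c u v; rewrite linearP.
  by rewrite (hquot_proj_lift (f := f)) //; apply: linearP.
exact: memv_img (memvf _).
Qed.

Section Twist.
Variables (M N : hmodule H) (Psi : 'M[F]_(hmod_deg N, hmod_deg M)).

(** The action of [h] on linear maps from [M] to [N], applied to [Psi]. *)
Definition twist h : 'M[F]_(hmod_deg N, hmod_deg M) :=
  \sw_(a, b <- comult h) (N a *m Psi *m M (antipode b)).

Lemma twist_linear : linear twist.
Proof. by rewrite /twist; mlin. Qed.

Lemma twist1 : twist 1 = Psi.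
Proof.
rewrite /twist comult1 tliftE; last by mlin.
by rewrite antipode1 !hmod_act1 mul1mx mulmx1.
Qed.

(** Evaluation from [Hom(M, N) (x) M] to [N] is [H]-linear: with [X = twist h], the last two factors
    of [g_1 X S(g_2) g_3] cancel. *)
Lemma mul_twist g h :
  \sw_(g1, g2 <- comult g) (twist (g1 * h) *m M g2) = N g *m twist h.
Proof.
transitivity (\sw_(g1, g2 <- comult g) \sw_(p, q <- comult g1)
   (N p *m (twist h *m (M (antipode q) *m M g2)))).
  apply: eq_tlift => g1 g2; rewrite /twist comultM_lift; last by mlin.
  rewrite (linear_tlift (g := fun A => A *m M g2)); last by mlin.
  apply: eq_tlift => p q.
  rewrite (linear_tlift (g := fun A => A *m M g2)); last by mlin.
  rewrite (linear_tlift (g := fun A => N p *m (A *m (M (antipode q) *m M g2)))); last by mlin.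
  by apply: eq_tlift => a b; rewrite antipodeM !hmod_actM !mulmxA.
rewrite (@comult_assoc _ _ _ (fun p q g2 => N p *m (twist h *m (M (antipode q) *m M g2))));
  [|move=> *; mlin ..].
rewrite -[RHS](@counitr_lfun _ _ _ (fun p => N p *m twist h)); last by mlin.
apply: eq_tlift => p g'.
transitivity (N p *m (twist h *m M (\sw_(q, r <- comult g') (antipode q * r)))).
  rewrite (linear_tlift (g := fun v => N p *m (twist h *m M v))); last by mlin.
  by apply: eq_tlift => q r; rewrite hmod_actM.
by rewrite antipodel linearZ /= hmod_act1 -scalemxAr mulmx1 -scalemxAr.
Qed.

Lemma hmod_twist g : N g *m Psi = \sw_(g1, g2 <- comult g) (twist g1 *m M g2).
Proof. by rewrite -{1}twist1 -mul_twist; apply: eq_tlift => a b; rewrite mulr1. Qed.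

Hypothesis kPsi : klinear K Psi.

(** [K]-linearity gives [c Psi S(d) = Psi c S(d)] for the legs [c], [d] of [k]. So [twist] factors
    through [pr] and its entries lie in [L^*]. *)
Lemma twist_mulK a k : k \in K -> twist (a * k) = (counit k : F) *: twist a.
Proof.
move=> Kk; rewrite /twist comultM_lift; last by mlin.
rewrite scale_tlift; apply: eq_tlift => a1 a2.
transitivity (N a1 *m Psi *m M (\sw_(c, d <- comult k) (c * antipode d)) *m M (antipode a2)).
  rewrite (linear_tlift (g := fun v => N a1 *m Psi *m M v *m M (antipode a2))); last by mlin.
  apply: (eq_tlift_in (nhs_comult nK Kk)); [by mlin|by mlin|] => c d Kc Kd.
  by rewrite antipodeM !hmod_actM !mulmxA -[N a1 *m N c *m Psi]mulmxA kPsi // !mulmxA.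
by rewrite antipoder linearZ /= hmod_act1 -scalemxAr mulmx1 -scalemxAl.
Qed.

Lemma twist_lift h : twist (quotv_val (pr h)) = twist h.
Proof. exact: (hquot_proj_lift _ twist_linear twist_mulK). Qed.

End Twist.

(** The left action of [H] on [H^*]; a subspace stable under it pulls back to a submodule in
    [linked_sim]. *)
Definition translate g (f : dual H) : dual H := linfun (fun h => f (h * g)).

Lemma translateE g f h : translate g f h = f (h * g).
Proof. by rewrite linfunE //; mlin. Qed.

Lemma translate_linear g : linear (translate g).
Proof.
by move=> c f1 f2; apply/lfunP => h; rewrite translateE !add_lfunE !scale_lfunE !translateE.
Qed.

Lemma translate_coefv M g f : f \in coefv M -> translate g f \in coefv M.
Proof.
suff /subvP S : (coefv M <= linfun (translate g) @^-1: coefv M)%VS.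
  by move=> /S; rewrite -memv_preim linfunE //; apply: translate_linear.
apply: coefv_subP => i j; rewrite -memv_preim linfunE; last exact: translate_linear.
have -> : translate g (@hmod_coef _ _ M i j) = \sum_p M g p j *: hmod_coef i p.
  apply/lfunP => h; rewrite translateE sum_lfunE hmod_coefE hmod_actM mxE.
  by apply: eq_bigr => p _; rewrite lfunE /= hmod_coefE [RHS]mulrC.
by apply: memv_suml => p _; rewrite memvZ ?hmod_coef_mem.
Qed.

Lemma hquot_dualv_repr f : f \in hquot_dualv nK ->
  exists u, f = hquot_dual (nK := nK) u.
Proof.
move=> /memv_imgP[u _ ->]; exists u; rewrite linfunE //; exact: hquot_dual_linear.
Qed.

Lemma translate_hquot_dualv g f :
  f \in hquot_dualv nK -> translate g f \in hquot_dualv nK.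
Proof.
move=> /hquot_dualv_repr[u ->]; apply: hquot_dualvP => a k Kk.
rewrite !translateE !lfunE /= -mulrA !hquot_projM (hquot_projK Kk) -scalerAl mul1r.
by rewrite -scalerAr linearZ.
Qed.

(** The action makes [H^*] a module algebra: [g (u v) = (g_1 u) (g_2 v)]. *)
Lemma translate_prod (U V : {vspace dual H}) :
  (forall g f, f \in U -> translate g f \in U) ->
  (forall g f, f \in V -> translate g f \in V) ->
  forall g f, f \in (U * V)%VS -> translate g f \in (U * V)%VS.
Proof.
move=> sU sV g f.
suff /subvP S : (U * V <= linfun (translate g) @^-1: (U * V))%VS.
  by move=> /S; rewrite -memv_preim linfunE //; apply: translate_linear.
apply/prodvP => u v Uu Vv; rewrite -memv_preim linfunE; last exact: translate_linear.
have -> : translate g (u * v) =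
    \sw_(a, b <- comult g) (translate a u * translate b v : dual H).
  apply/lfunP => h; rewrite translateE dual_mulE comultM_lift; last by mlin.
  rewrite (linear_tlift (g := fun f : dual H => f h)); last first.
    by move=> c f1 f2; rewrite !lfunE /= lfunE.
  rewrite exchange_tlift; apply: eq_tlift => a b; rewrite dual_mulE.
  by apply: eq_tlift => c d; rewrite !translateE.
by apply: tlift_mem => a b; rewrite memv_mul ?sU ?sV.
Qed.

(** For a fixed row [i], the vectors [v] such that [h |-> (N(h) v)_i] lies in [W] form a submodule,
    as [W] is stable under [translate]. It contains the columns of [Psi], hence is everything by
    simplicity. *)
Lemma linked_sim M N : simple_hmodule N -> linked K M N ->
  (coefv N <= hquot_dualv nK * coefv M)%VS.
Proof.
move=> [N0 simN] [Psi kPsi nz].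
set W := (hquot_dualv nK * coefv M)%VS.
apply: coefv_subP => i j.
pose c (v : 'cV[F]_(hmod_deg N)) : dual H := linfun (fun h => (N h *m v) i 0 : F^o).
have cE v h : c v h = (N h *m v) i 0 by rewrite linfunE //; mlin.
have lc : linear c.
  move=> d u v; apply/lfunP => h.
  by rewrite lfunE /= lfunE /= !cE linearP !mxE.
pose U := (linfun c @^-1: W)%VS.
have UE v : (v \in U) = (c v \in W) by rewrite -memv_preim linfunE.
have Ustab a v : v \in U -> N a *m v \in U.
  rewrite !UE => Wv; have -> : c (N a *m v) = translate a (c v).
    by apply/lfunP => h; rewrite translateE !cE hmod_actM mulmxA.
  apply: translate_prod Wv; [exact: translate_hquot_dualv|exact: translate_coefv].
have colU q : col q Psi \in U.
  rewrite UE; pose f p : dual H := linfun (fun h => twist Psi h i p : F^o).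
  have fE p h : f p h = twist Psi h i p.
    by rewrite linfunE //; apply: lin_entry; apply: twist_linear.
  (* [N(h) Psi = twist(h_1) M(h_2)] writes this function as a sum of products of entries of [twist],
     in [L^*], with coefficients of [M]. *)
  have -> : c (col q Psi) = \sum_p f p * hmod_coef p q.
    apply/lfunP => h; rewrite cE colE mulmxA -colE mxE hmod_twist.
    rewrite (linear_tlift (g := fun A : 'M[F]_(_, _) => A i q : F^o)); last by mlin.
    under eq_tlift => a b do rewrite mxE.
    rewrite sum_lfunE -sum_tlift; apply: eq_bigr => p _; rewrite dual_mulE.
    by apply: eq_tlift => a b; rewrite fE hmod_coefE.
  apply: memv_suml => p _; rewrite memv_mul ?hmod_coef_mem //.
  by apply: hquot_dualvP => a k Kk; rewrite !fE twist_mulK // mxE.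
case: (simN U Ustab) => [U0|Uf].
  case/eqP: nz; apply/matrixP => p q; have := colU q; rewrite U0 memv0 => /eqP/matrixP/(_ p 0).
  by rewrite !mxE.
have : delta_mx j 0 \in U by rewrite Uf memvf.
rewrite UE; congr (_ \in W); apply/lfunP => h.
by rewrite cE -colE mxE hmod_coefE.
Qed.

Variable x : H.
Hypotheses (intx : left_integral K x) (counitx : counit x = 1).

(** Without a link, the functional [T], built from [x] and a coefficient of [N], vanishes on
    [coefv M] by orthogonality, then on its product with [L^*], which contains [coefv N]. This
    contradicts [coef_neq0]. *)
Lemma sim_linked M N : (0 < hmod_deg N)%N ->
  (coefv N <= hquot_dualv nK * coefv M)%VS -> linked K M N.
Proof.
move=> N0 sNM; apply: contrapT => /(unlinked_coef nK intx) E.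
apply: (coef_neq0 counitx N0) => i j.
pose T (c : dual H) : F^o := \sw_(a, b <- comult x) (N a i j * c (antipode b) : F^o).
have lT : linear T.
  move=> d f g; rewrite /T scale_tlift /tlift -big_split; apply: eq_bigr => p _ /=.
  rewrite -big_split; apply: eq_bigr => q _ /=.
  by rewrite -scalerDr !lfunE /= lfunE /= mulrDr; congr (_ *: (_ + _)); exact: mulrCA.
suff S : (hquot_dualv nK * coefv M <= lker (linfun T))%VS.
  move=> p q; have /(subvP (subv_trans sNM S)) := hmod_coef_mem p q.
  rewrite memv_ker linfunE // => /eqP <-.
  by apply: eq_tlift => a b; rewrite hmod_coefE.
apply/prodvP => _ c /hquot_dualv_repr[u ->] Mc; rewrite memv_ker linfunE //.
have T0 : T c = 0.
  suff /subvP/(_ c Mc) : (coefv M <= lker (linfun T))%VS.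
    by rewrite memv_ker linfunE // => /eqP.
  apply: coefv_subP => p q; rewrite memv_ker linfunE //; apply/eqP.
  by rewrite -[RHS](E i j p q); apply: eq_tlift => a b; rewrite hmod_coefE.
(* The legs of [x] and their antipodes lie in [K], where an element of [L^*] is its value at 1 times
   the counit. *)
have -> : T (hquot_dual u * c) = u 1 * T c; last by rewrite T0 mulr0.
rewrite /T (linear_tlift (g := fun y : F^o => u 1 * y : F^o)); last by mlin.
apply: (eq_tlift_in (nhs_comult nK intx.1)); [by mlin|by mlin|] => a b Ka Kb.
rewrite mulrCA; congr (_ * _); set k := antipode b.
have Kk : k \in K by rewrite (nhs_antipode nK).
rewrite dual_mulE.
transitivity (\sw_(p, q <- comult k) ((counit p : F) *: (u 1 * c q : F^o))).
  apply: (eq_tlift_in (nhs_comult nK Kk)); [by mlin|by mlin|] => p q Kp Kq.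
  by rewrite lfunE /= hquot_projK // linearZ /= -scalerAl.
by rewrite counitl_lfun //; mlin.
Qed.

End Similarity.

(** * Traces and proportional restricted characters *)

(** In the rank factorisation [A = C R], [C] is left and [R] right invertible, so idempotence forces
    [R C = 1], and [R C] has the trace of [A]. *)
Lemma mxtrace_idempotent (F : fieldType) n (A : 'M[F]_n) :
  A *m A = A -> \tr A = (\rank A)%:R.
Proof.
move=> AA; rewrite -{1}(mulmx_base A) mxtrace_mulC.
have [B BC] := row_fullP (col_base_full A).
have [D RD] := row_freeP (row_base_free A).
suff -> : row_base A *m col_base A = 1%:M by rewrite mxtrace1.
have: (col_base A *m row_base A) *m (col_base A *m row_base A) =
    col_base A *m row_base A by rewrite mulmx_base.
move: (col_base A) (row_base A) BC RD => C R BC RD /(congr1 (fun X => B *m X *m D)).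
by rewrite !mulmxA BC mul1mx -!mulmxA RD mulmx1.
Qed.

Lemma mxtrace_tens (F : fieldType) m n (A : 'M[F]_m) (B : 'M[F]_n) :
  \tr (tensmx A B) = \tr A * \tr B.
Proof.
rewrite /mxtrace mulr_sum; apply: eq_bigr => i _.
by case: (mxtens_indexP i) => i0 i1; rewrite tensmxE mxtens_indexK.
Qed.

(** Without a link, orthogonality kills the pairing at [x] of the characters of [N] and [M], hence
    by proportionality that of [M] with itself. The latter is the trace of the idempotent [T x],
    which therefore has rank 0, against [coef_neq0]. *)
Lemma proportional_linked (F : fieldType) (H : hopfAlgType F) (K : {vspace H})
    (nK : normal_hopf_subalg K) x (M N : hmodule H) (c : F) :
  [pchar F] =i pred0 -> left_integral K x -> counit x = 1 ->
  (0 < hmod_deg M)%N -> c != 0 ->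
  (forall k, k \in K -> \tr (N k) = c * \tr (M k)) -> linked K M N.
Proof.
move=> char0 intx counitx M0 nzc trNM; apply: contrapT => /(unlinked_coef nK intx) E.
have comultx := nhs_comult nK intx.1.
have trM0 : \sw_(a, b <- comult x) (\tr (M a) * \tr (M (antipode b)) : F^o) = 0.
  apply: (mulfI nzc); rewrite mulr0.
  rewrite (linear_tlift (g := fun y : F^o => c * y : F^o)); last by mlin.
  transitivity (\sw_(a, b <- comult x) (\sum_i \sum_j (N a i i * M (antipode b) j j) : F^o)).
    apply: (eq_tlift_in (X := F^o) comultx); [by mlin|by mlin|].
    move=> a b Ka Kb; rewrite mulrA -trNM // /mxtrace mulr_suml.
    by apply: eq_bigr => i _; rewrite mulr_sumr.
  rewrite -sum_tlift big1 // => i _; rewrite -sum_tlift big1 // => j _; exact: E.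
(* [T] is the action of [H] on endomorphisms of [M] as a Kronecker product; the transpose offsets
   the antipode reversing products. *)
pose T h := \sw_(a, b <- comult h) (tensmx (M a) (M (antipode b))^T).
have TM g h : T (g * h) = T g *m T h.
  rewrite /T comultM_lift; last by mlin.
  rewrite (linear_tlift (g := fun A => A *m T h)); last by mlin.
  apply: eq_tlift => a b.
  rewrite (linear_tlift (g := fun A => tensmx (M a) (M (antipode b))^T *m A)); last by mlin.
  by apply: eq_tlift => p q; rewrite tensmx_mul antipodeM !hmod_actM trmx_mul.
have idT : T x *m T x = T x.
  by rewrite -TM intx.2 ?intx.1 // counitx scale1r.
have trT : \tr (T x) = 0.
  rewrite -[RHS]trM0 (linear_tlift (g := fun A : 'M[F]_(_, _) => \tr A : F^o)); last by mlin.
  by apply: (@eq_tlift _ _ _ F^o) => a b; rewrite mxtrace_tens mxtrace_tr.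
have T0 : T x = 0.
  apply/eqP; rewrite -mxrank_eq0; apply/negPn/negP => rk0.
  move/eqP: trT; rewrite mxtrace_idempotent //.
  by rewrite ((pcharf0P F).1 char0) (negPf rk0).
apply: (coef_neq0 counitx M0) => i j p q.
have := congr1 (fun A : 'M[F]_(_, _) => A (mxtens_index (i, q)) (mxtens_index (j, p))) T0.
rewrite mxE (linear_tlift (g := fun A : 'M[F]_(_, _) => A _ _ : F^o)); last by mlin.
by move=> <-; apply: (@eq_tlift _ _ _ F^o) => a b; rewrite tensmxE mxE.
Qed.

(** * Composition factors *)

Lemma linear_mulmx_repr (F : fieldType) m n (f : 'cV[F]_n -> 'cV[F]_m) :
  linear f -> exists A : 'M[F]_(m, n), forall v, A *m v = f v.
Proof.
move=> lf; exists (\matrix_(i, j) f (delta_mx j 0) i 0) => v.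
have [f' Df] := linear_pack lf.
rewrite Df {2}[v]matrix_sum_delta linear_sum; apply/matrixP => i j.
rewrite ord1 mxE summxE; apply: eq_bigr => k _.
by rewrite big_ord1 linearZ !mxE /= -Df mulrC.
Qed.

Lemma eq_mulmx_cV (F : fieldType) m n (A B : 'M[F]_(m, n)) :
  (forall v : 'cV[F]_n, A *m v = B *m v) -> A = B.
Proof.
move=> AB; apply/matrixP => i j; have /matrixP/(_ i 0) := AB (delta_mx j 0).
by rewrite -!colE !mxE.
Qed.

(** [B] is the inclusion of [U] written in a basis, [B'] the projection onto [U] along [V]. *)
Lemma vspace_coordinates (F : fieldType) n (U V : {vspace 'cV[F]_n}) :
  (U :&: V)%VS = 0%VS -> exists (B : 'M[F]_(n, \dim U)) (B' : 'M[F]_(\dim U, n)),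
  [/\ B' *m B = 1%:M, forall v, B *m B' *m v = daddv_pi U V v,
      forall w, B *m w \in U
    & forall v, daddv_pi U V v = 0 -> B' *m v = 0].
Proof.
move=> UV0; pose e := vbasis U.
have lf : linear (fun w : 'cV[F]_(\dim U) => \sum_i w i 0 *: e`_i).
  move=> c u v; rewrite scaler_sumr -big_split; apply: eq_bigr => i _ /=.
  by rewrite !mxE scalerDl scalerA.
have lp : linear (fun v : 'cV[F]_n => \col_i coord e i (daddv_pi U V v)).
  by move=> c u v; apply/matrixP => i j; rewrite !mxE !linearP.
have [B DB] := linear_mulmx_repr lf; have [B' DB'] := linear_mulmx_repr lp.
have BU w : B *m w \in U.
  rewrite DB; apply: memv_suml => i _; rewrite memvZ //.
  by rewrite vbasis_mem ?mem_nth ?size_tuple.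
exists B, B'; split=> //.
- apply: eq_mulmx_cV => w; rewrite -mulmxA DB' daddv_pi_id // mul1mx DB.
  apply/matrixP => i j; rewrite ord1 mxE linear_sum (bigD1 i) //= big1 => [|k ki].
    by rewrite linearZ /= coord_free ?(basis_free (vbasisP _)) // eqxx mulr1 addr0.
  by rewrite linearZ /= coord_free ?(basis_free (vbasisP _)) // (negPf ki) mulr0.
- move=> v; rewrite -mulmxA DB DB' [RHS](coord_vbasis (memv_pi _ _ _)).
  by apply: eq_bigr => i _; rewrite mxE.
- by move=> v v0; rewrite DB' v0; apply/matrixP => i j; rewrite !mxE linear0.
Qed.

Section Modules.
Variables (F : fieldType) (A : falgType F).
Implicit Types M N : hmodule A.

Definition hmod_hom M N (Phi : 'M[F]_(hmod_deg N, hmod_deg M)) :=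
  forall a, N a *m Phi = Phi *m M a.

(** [N1] is the submodule [U], and [N2] the quotient by it, carried by a complement. Of the four
    maps only the inclusion [B] and the projection [C'] are claimed to commute with the action. *)
Lemma submodule_split N (U : {vspace 'cV[F]_(hmod_deg N)}) :
  (forall a v, v \in U -> N a *m v \in U) -> U <> 0%VS -> U <> fullv ->
  exists N1 N2 (B : 'M[F]_(hmod_deg N, hmod_deg N1)) B'
    (C : 'M[F]_(hmod_deg N, hmod_deg N2)) C',
  [/\ (hmod_deg N1 < hmod_deg N)%N /\ (hmod_deg N2 < hmod_deg N)%N,
      hmod_hom B /\ hmod_hom C', B' *m B = 1%:M /\ C' *m C = 1%:M
    & B *m B' + C *m C' = 1%:M].
Proof.
move=> stabU U0 Uf.
have UC0 := capv_compl U; have CU0 : (U^C :&: U)%VS = 0%VS by rewrite capvC.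
have [B [B' [B'B BB' BU _]]] := vspace_coordinates UC0.
have [C [C' [C'C CC' _ C'0]]] := vspace_coordinates CU0.
have sum1 : B *m B' + C *m C' = 1%:M.
  apply: eq_mulmx_cV => v; rewrite mulmxDl BB' CC' mul1mx daddv_pi_add //.
  by rewrite addv_complf memvf.
have C'B v : v \in U -> C' *m v = 0.
  move=> Uv; apply: C'0; have := @daddv_pi_add _ _ U U^C v UC0.
  rewrite addv_complf memvf => /(_ isT); rewrite daddv_pi_id // => /(canRL (addKr _)).
  by rewrite addNr.
(* Stability of [U] makes the action block triangular. *)
have C'NB a : C' *m N a *m B = 0.
  by apply: eq_mulmx_cV => w; rewrite mul0mx -!mulmxA C'B // stabU.
have homB a : B *m (B' *m N a *m B) = N a *m B.
  rewrite -[N a *m B in RHS]mul1mx -sum1 mulmxDl -[C *m C' *m _]mulmxA.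
  by rewrite [C' *m _]mulmxA C'NB mulmx0 addr0 !mulmxA.
have homC a : C' *m N a *m C *m C' = C' *m N a.
  rewrite -[C' *m N a in RHS]mulmx1 -sum1 mulmxDr !mulmxA C'NB mul0mx.
  by rewrite add0r.
pose f1 := linfun (fun a => B' *m N a *m B).
have f1E a : f1 a = B' *m N a *m B by rewrite linfunE //; mlin.
pose f2 := linfun (fun a => C' *m N a *m C).
have f2E a : f2 a = C' *m N a *m C by rewrite linfunE //; mlin.
have f11 : f1 1 = 1%:M by rewrite f1E hmod_act1 mulmx1.
have f21 : f2 1 = 1%:M by rewrite f2E hmod_act1 mulmx1.
have f1M a b : f1 (a * b) = f1 a *m f1 b.
  by rewrite !f1E hmod_actM -[RHS]mulmxA homB !mulmxA.
have f2M a b : f2 (a * b) = f2 a *m f2 b.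
  by rewrite !f2E hmod_actM !mulmxA homC.
exists (HModule f11 f1M), (HModule f21 f2M), B, B', C, C'; split=> //=.
- have := dimv_compl U; rewrite dimvf /dim /= muln1 => dC.
  have d0 : (0 < \dim U)%N by rewrite lt0n dimv_eq0; apply/eqP.
  have df : (\dim U < hmod_deg N)%N.
    have := dimvS (subvf U); rewrite leq_eqVlt dimvf /dim /= muln1 => /orP[/eqP E|//].
    by case: Uf; apply/eqP; rewrite eqEdim subvf /= dimvf /dim /= muln1 E.
  by split=> //; rewrite dC ltn_subrL d0 (leq_trans _ df).
- by split=> a; rewrite /= ?f1E ?f2E ?homB ?homC.
Qed.

(** By Schur's lemma [Phi] is invertible, so it conjugates one action into the other. *)
Lemma simple_hom_char M N (Phi : 'M[F]_(hmod_deg N, hmod_deg M)) :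
  simple_hmodule M -> simple_hmodule N -> hmod_hom Phi -> Phi != 0 ->
  forall a, \tr (N a) = \tr (M a).
Proof.
move=> [_ simM] [_ simN] homP nz.
have lP : linear (fun v : 'cV[F]_(hmod_deg M) => Phi *m v) by mlin.
have LE v : linfun (fun v : 'cV[F]_(hmod_deg M) => Phi *m v) v = Phi *m v by rewrite linfunE.
pose L := linfun (fun v : 'cV[F]_(hmod_deg M) => Phi *m v).
have ker0 : lker L = 0%VS.
  case: (simM (lker L)) => [a v|//|kerf].
    by rewrite !memv_ker !LE mulmxA -homP -mulmxA => /eqP ->; rewrite mulmx0.
  case/eqP: nz; apply: eq_mulmx_cV => v; rewrite mul0mx -LE.
  by apply/eqP; rewrite -memv_ker kerf memvf.
have imf : limg L = fullv.
  case: (simN (limg L)) => [a _ /memv_imgP[v _ ->]|im0|//].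
    by rewrite LE mulmxA homP -mulmxA -LE memv_img ?memvf.
  case/eqP: nz; apply: eq_mulmx_cV => v; rewrite mul0mx -LE.
  by apply/eqP; rewrite -memv0 -im0 memv_img ?memvf.
have injL : injective L by apply/lker0P; rewrite ker0.
pose g w := (L^-1)%VF w.
have lg : linear g by move=> c u v; rewrite /g linearP.
have [Q DQ] := linear_mulmx_repr lg.
have PQ : Phi *m Q = 1%:M.
  apply: eq_mulmx_cV => v; rewrite mul1mx -mulmxA DQ -LE -/L.
  by rewrite /g limg_lfunVK ?imf ?memvf.
have QP : Q *m Phi = 1%:M.
  by apply: eq_mulmx_cV => v; apply: injL; rewrite mul1mx -mulmxA !LE mulmxA PQ mul1mx.
move=> a; rewrite -[N a]mulmx1 -PQ mulmxA homP mxtrace_mulC mulmxA QP mul1mx.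
by [].
Qed.

(** Induction on the degree through [submodule_split]; [G] stands for a property inherited by
    submodules and quotients. The last clause finds the character of every simple quotient of [N]
    among the factors. *)
Lemma composition_factors (G : hmodule A -> Prop) :
  (forall N N1 (B : 'M[F]_(hmod_deg N, hmod_deg N1)) B',
     hmod_hom B -> B' *m B = 1%:M -> G N -> G N1) ->
  (forall N N2 (C' : 'M[F]_(hmod_deg N2, hmod_deg N)) C,
     hmod_hom C' -> C' *m C = 1%:M -> G N -> G N2) ->
  forall N, G N -> exists m (Y : 'I_m -> hmodule A),
  [/\ forall i, simple_hmodule (Y i), forall i, G (Y i),
      forall a, \tr (N a) = \sum_i \tr (Y i a)
    & forall M (Phi : 'M[F]_(hmod_deg M, hmod_deg N)),
        simple_hmodule M -> hmod_hom Phi -> Phi != 0 ->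
        exists i, forall a, \tr (M a) = \tr (Y i a)].
Proof.
move=> Gsub Gquo N; have [n] := ubnP (hmod_deg N).
elim: n N => // n IH N /ltnSE leNn GN.
have [N0|Npos] := posnP (hmod_deg N).
  exists 0%N, (fun=> N); split=> [[]|[]|a|M Phi _ _] //.
    by rewrite big_ord0 /mxtrace big1 // => i _; have := ltn_ord i; rewrite {2}N0.
  by case/eqP; apply/matrixP => i j; have := ltn_ord j; rewrite {2}N0.
case: (pselect (simple_hmodule N)) => [simN|nsimN].
  exists 1%N, (fun=> N); split=> // [a|M Phi simM homP nz].
    by rewrite big_ord1.
  by exists ord0; apply: simple_hom_char homP nz.
have [U [stabU U0 Uf]] : exists U : {vspace 'cV[F]_(hmod_deg N)},
    [/\ forall a v, v \in U -> N a *m v \in U, U <> 0%VS & U <> fullv].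
  apply: contrapT => noU; apply: nsimN; split=> // U stabU.
  case: (pselect (U = 0%VS)) => [|U0]; first by left.
  case: (pselect (U = fullv)) => [|Uf]; first by right.
  by case: noU; exists U.
have [N1 [N2 [B [B' [C [C' [[d1 d2] [homB homC] [B'B C'C] sum1]]]]]]] :=
  submodule_split stabU U0 Uf.
have [m1 [Y1 [sim1 G1 tr1 hom1]]] := IH N1 (leq_trans d1 leNn) (Gsub _ _ _ _ homB B'B GN).
have [m2 [Y2 [sim2 G2 tr2 hom2]]] := IH N2 (leq_trans d2 leNn) (Gquo _ _ _ _ homC C'C GN).
exists (m1 + m2)%N, (fun i => match split i with inl j => Y1 j | inr j => Y2 j end).
have splL j : split (lshift m2 j) = inl j :> 'I_m1 + 'I_m2 := unsplitK (inl j).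
have splR j : split (rshift m1 j) = inr j :> 'I_m1 + 'I_m2 := unsplitK (inr j).
split=> [i|i|a|M Phi simM homP nz].
- by case: (split i).
- by case: (split i).
- rewrite big_split_ord /=; under eq_bigr do rewrite splL.
  under [X in _ + X]eq_bigr do rewrite splR.
  rewrite -tr1 -tr2 -[N a]mulmx1 -sum1 mulmxDr linearD /=; congr (_ + _).
    by rewrite mulmxA homB mxtrace_mulC mulmxA B'B mul1mx.
  by rewrite mulmxA mxtrace_mulC mulmxA -homC -mulmxA C'C mulmx1.
(* [Phi] either kills the submodule and factors through the quotient, or is nonzero on the
   submodule. *)
case: (eqVneq (Phi *m B) 0) => [PB0|nzB].
  have PC : Phi *m C *m C' = Phi.
    by rewrite -[RHS]mulmx1 -sum1 mulmxDr !mulmxA PB0 mul0mx add0r.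
  have [||i E] := hom2 M (Phi *m C) simM.
  - move=> a; rewrite mulmxA homP -[N2 a]mulmx1 -C'C.
    by rewrite [N2 a *m _]mulmxA homC !mulmxA PC.
  - by apply: contraNneq nz => PC0; rewrite -PC PC0 mul0mx.
  by exists (rshift m1 i) => a; rewrite splR.
have [||i E] := hom1 M (Phi *m B) simM => //.
  by move=> a; rewrite mulmxA homP -!mulmxA homB.
by exists (lshift m2 i) => a; rewrite splL.
Qed.

End Modules.

(** * The regular module and the finiteness of the set of simple characters *)

Section RegularModule.
Variables (F : fieldType) (A : falgType F).
Let e := vbasis {:A}.

Definition reg_mx (a : A) : 'M[F]_(\dim {:A}) := \matrix_(i, j) coord e i (a * e`_j).

Lemma reg_mx_linear : linear reg_mx.
Proof.
move=> c a b; apply/matrixP => i j.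
by rewrite !mxE mulrDl linearD -scalerAl linearZ.
Qed.

Let regE a : linfun reg_mx a = reg_mx a.
Proof. by rewrite linfunE //; apply: reg_mx_linear. Qed.

Lemma reg_mx_expand (a : A) (j : 'I_(\dim {:A})) : a * e`_j = \sum_i reg_mx a i j *: e`_i.
Proof. by rewrite [LHS](coord_vbasis (memvf _)); apply: eq_bigr => i _; rewrite mxE. Qed.

Let reg1 : linfun reg_mx 1 = 1%:M.
Proof.
rewrite regE; apply/matrixP => i j; rewrite !mxE mul1r.
by rewrite coord_free ?(basis_free (vbasisP _)) // eq_sym.
Qed.

Let regM a b : linfun reg_mx (a * b) = linfun reg_mx a *m linfun reg_mx b.
Proof.
rewrite !regE; apply/matrixP => i j; rewrite !mxE -mulrA (reg_mx_expand b) mulr_sumr linear_sum.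
by apply: eq_bigr => k _; rewrite -scalerAr linearZ !mxE mulrC.
Qed.

Definition regular_hmodule := HModule reg1 regM.

Lemma regular_hmoduleE a i j : regular_hmodule a i j = coord e i (a * e`_j).
Proof. by rewrite /= regE mxE. Qed.

(* A simple module is a quotient of the regular one, hence affords the
   character of one of its composition factors.                           *)
Lemma finite_simple_chars : exists m (Y : 'I_m -> hmodule A),
  forall M, simple_hmodule M -> exists i, forall a, \tr (M a) = \tr (Y i a).
Proof.
have [m [Y [_ _ _ homY]]] := @composition_factors _ A (fun=> True)
  (fun _ _ _ _ _ _ _ => I) (fun _ _ _ _ _ _ _ => I) regular_hmodule I.
exists m, Y => M simM.
have [M0 _] := simM.
pose v : 'cV[F]_(hmod_deg M) := delta_mx (Ordinal M0) 0.
pose Phi : 'M[F]_(hmod_deg M, hmod_deg regular_hmodule) := \matrix_(i, j) (M e`_j *m v) i 0.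
apply: (homY M Phi simM) => [a|].
  apply/matrixP => i j; rewrite !mxE.
  transitivity ((M (a * e`_j) *m v) i 0).
    by rewrite hmod_actM -mulmxA [RHS]mxE; apply: eq_bigr => k _; rewrite mxE.
  rewrite (reg_mx_expand a) linear_sum mulmx_suml summxE; apply: eq_bigr => k _.
  by rewrite linearZ -scalemxAl !mxE regular_hmoduleE mulrC.
apply/eqP => Phi0; have : M 1 *m v = 0.
  rewrite (coord_vbasis (memvf 1)) linear_sum mulmx_suml big1 // => j _.
  rewrite linearZ -scalemxAl; apply/matrixP => i i0; rewrite ord1 !mxE.
  have /matrixP/(_ i j) := Phi0; rewrite !mxE => ->; exact: mulr0.
rewrite hmod_act1 mul1mx => /matrixP/(_ (Ordinal M0) 0); rewrite !mxE !eqxx.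
by move/eqP; rewrite oner_eq0.
Qed.

End RegularModule.

(** * The module [L (x) M] *)

Lemma sum_mxtens (V : nmodType) m n (f : 'I_(m * n) -> V) :
  \sum_l f l = \sum_i \sum_j f (mxtens_index (i, j)).
Proof.
rewrite pair_big (reindex (@mxtens_index m n)) /=; first by apply: eq_bigr => -[].
by exists (@mxtens_unindex m n) => ? _; rewrite ?mxtens_indexK ?mxtens_unindexK.
Qed.

Lemma tensmx1 (F : fieldType) m n : tensmx (1%:M : 'M[F]_m) (1%:M : 'M[F]_n) = 1%:M.
Proof.
apply/matrixP => i j; case: (mxtens_indexP i) => i0 i1; case: (mxtens_indexP j) => j0 j1.
by rewrite tensmxE !mxE (can_eq (@mxtens_indexK _ _)) xpair_eqE -natrM mulnb.
Qed.

Section QuotientTensor.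
Variables (F : fieldType) (H : hopfAlgType F) (K : {vspace H}).
Hypothesis nK : normal_hopf_subalg K.
Local Notation L := (hquot nK).
Local Notation pr := (hquot_proj nK).
Local Notation RL := (regular_hmodule L).
Let e := vbasis {:L}.
Variable M : hmodule H.

Let act h := \sw_(a, b <- comult h) (tensmx (RL (pr a)) (M b)).

Let actE h : linfun act h = act h. Proof. by rewrite linfunE // /act; mlin. Qed.

Let act1 : linfun act 1 = 1%:M.
Proof.
rewrite actE /act comult1 tliftE; last by mlin.
by rewrite hquot_proj1 !hmod_act1 tensmx1.
Qed.

Let actM g h : linfun act (g * h) = linfun act g *m linfun act h.
Proof.
rewrite !actE {1}/act comultM_lift; last by mlin.
rewrite (linear_tlift (g := fun A => A *m act h)); last by mlin.
apply: eq_tlift => a b.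
rewrite (linear_tlift (g := fun A => tensmx (RL (pr a)) (M b) *m A)); last by mlin.
by apply: eq_tlift => p q; rewrite tensmx_mul hquot_projM !hmod_actM.
Qed.

Definition quot_tens := HModule act1 actM.

(** [K] acts on [L] through the counit, so over [K] the module is a sum of [dim L] copies of [M]. *)
Lemma quot_tensK k : k \in K -> quot_tens k = tensmx 1%:M (M k).
Proof.
move=> Kk; rewrite /= actE.
transitivity (\sw_(a, b <- comult k) ((counit a : F) *: tensmx (1%:M : 'M[F]_(\dim {:L})) (M b))).
  apply: (eq_tlift_in (nhs_comult nK Kk)); [by mlin|by mlin|] => a b Ka Kb.
  have -> : RL (pr a) = (counit a : F) *: 1%:M.
    by rewrite hquot_projK // linearZ -(hmod_act1 RL).
  apply/matrixP => i j.
  by rewrite !mxE mulrA.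
by rewrite counitl_lfun //; mlin.
Qed.

(** [Phi] sends [y (x) m] to [T(y) m]. It is [H]-linear by [mul_twist], and nonzero because [T]
    takes the value [Psi] at the class of 1. *)
Lemma quot_tens_hom N (Psi : 'M[F]_(hmod_deg N, hmod_deg M)) :
  klinear K Psi -> Psi != 0 ->
  exists2 Phi : 'M[F]_(hmod_deg N, hmod_deg quot_tens), hmod_hom Phi & Phi != 0.
Proof.
move=> kPsi nz; pose T (y : L) := twist Psi (quotv_val y).
have lT : linear T by move=> c u v; rewrite /T twist_linear.
have Tpr h : T (pr h) = twist Psi h by apply: twist_lift.
exists (\matrix_(i, l) T e`_(mxtens_unindex l).1 i (mxtens_unindex l).2).
  move=> g; apply/matrixP => i l; case: (mxtens_indexP l) => j p.
  transitivity ((N g *m T e`_j) i p).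
    by rewrite !mxE; apply: eq_bigr => q _; rewrite mxE mxtens_indexK.
  rewrite /T -mul_twist (linear_tlift (g := fun A : 'M[F]_(_, _) => A i p : F^o)); last by mlin.
  rewrite mxE sum_mxtens.
  transitivity (\sw_(g1, g2 <- comult g) (\sum_(j' < \dim {:L}) \sum_q
     (T e`_j' i q * (RL (pr g1) j' j * M g2 q p)) : F^o)).
    apply: (@eq_tlift _ _ _ F^o) => g1 g2; rewrite -Tpr hquot_projM.
    have -> : pr (quotv_val e`_j) = e`_j by apply: quotv_valK.
    have [T' DT] := linear_pack lT.
    rewrite (reg_mx_expand (pr g1)) DT linear_sum mulmx_suml summxE.
    apply: eq_bigr => j' _; rewrite linearZ -scalemxAl mxE [X in _ * X]mxE mulr_sumr.
    apply: eq_bigr => q _; rewrite regular_hmoduleE mxE.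
    by rewrite mulrCA.
  rewrite -sum_tlift; apply: eq_bigr => j' _; rewrite -sum_tlift; apply: eq_bigr => q _.
  rewrite mxE mxtens_indexK /= actE.
  rewrite (linear_tlift (g := fun A : 'M[F]_(_, _) =>
     T e`_j' i q * A (mxtens_index (j', q)) (mxtens_index (j, p)) : F^o)); last by mlin.
  by apply: (@eq_tlift _ _ _ F^o) => a b; rewrite tensmxE.
apply: contraNneq nz => Phi0; apply/eqP; rewrite -(twist1 Psi) -Tpr.
have [T' DT] := linear_pack lT.
rewrite DT [pr 1](coord_vbasis (memvf _)) linear_sum big1 // => j _.
rewrite linearZ -DT; apply/matrixP => i p; rewrite !mxE.
have /matrixP/(_ i (mxtens_index (j, p))) := Phi0.
by rewrite !mxE mxtens_indexK /= => ->; rewrite mulr0.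
Qed.

(** The images of the [K]-linear maps from [M] span [N], said dually: no nonzero linear form [w]
    kills them all. *)
Definition K_covered N := forall w : 'rV[F]_(hmod_deg N), w != 0 ->
  exists2 Phi : 'M[F]_(hmod_deg N, hmod_deg M), klinear K Phi & w *m Phi != 0.

Lemma quot_tens_covered : K_covered quot_tens.
Proof.
move=> w nzw.
have [l nzl] : exists l, w 0 l != 0.
  apply: contrapT => none; case/eqP: nzw; apply/matrixP => i l; rewrite ord1 mxE.
  by apply/eqP; apply: contrapT => /negP nz; apply: none; exists l.
move: nzl; case: (mxtens_indexP l) => j p nzl.
(* The copy of [M] at the basis vector [e_j] of [L], chosen so that [w] is nonzero on it. *)
exists (\matrix_(l, q) (l == mxtens_index (j, q))%:R) => [k Kk|].
  rewrite quot_tensK //; apply/matrixP => l' q; case: (mxtens_indexP l') => a b.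
  rewrite !mxE (bigD1 (mxtens_index (j, q))) //= big1 => [|i ni]; last first.
    by rewrite mxE (negPf ni) mulr0.
  rewrite (bigD1 b) //= big1 => [|i ni]; last first.
    rewrite mxE (can_eq (@mxtens_indexK _ _)) xpair_eqE.
    by rewrite [b == i]eq_sym (negPf ni) andbF mul0r.
  rewrite tensmxE !mxE eqxx mulr1 !addr0 (can_eq (@mxtens_indexK _ _)) xpair_eqE eqxx andbT.
  by [].
apply/eqP => /matrixP/(_ 0 p)/eqP; rewrite !mxE (bigD1 (mxtens_index (j, p))) //= big1 => [|i ni].
  by rewrite mxE eqxx mulr1 addr0 (negPf nzl).
by rewrite mxE (negPf ni) mulr0.
Qed.

End QuotientTensor.

(** * The maximum principle *)

Section Harmonic.
Import Order.TTheory Num.Theory.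
Variables (F : numFieldType) (H : hopfAlgType F) (K : {vspace H}).
Hypothesis nK : normal_hopf_subalg K.
Variable x : H.
Hypotheses (intx : left_integral K x) (counitx : counit x = 1).
Implicit Types M N : hmodule H.

Lemma klinear_comp M N P (A : 'M[F]_(hmod_deg P, hmod_deg N))
    (B : 'M[F]_(hmod_deg N, hmod_deg M)) :
  klinear K A -> klinear K B -> @klinear _ _ K M P (A *m B).
Proof. by move=> kA kB k Kk; rewrite mulmxA kA // -mulmxA kB // mulmxA. Qed.

Lemma covered_quot M N N2 (C' : 'M[F]_(hmod_deg N2, hmod_deg N)) C :
  hmod_hom C' -> C' *m C = 1%:M -> K_covered K M N -> K_covered K M N2.
Proof.
move=> homC C'C covN w nzw; have [|Phi kPhi nz] := covN (w *m C').
  by apply: contraNneq nzw => wC; rewrite -[w]mulmx1 -C'C mulmxA wC mul0mx.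
exists (C' *m Phi); last by rewrite mulmxA.
by apply: klinear_comp => // k _; apply: homC.
Qed.

(** Averaging the linear retraction [B'] gives a [K]-linear one, so over [K] the submodule is also a
    quotient. *)
Lemma covered_sub M N N1 (B : 'M[F]_(hmod_deg N, hmod_deg N1)) B' :
  hmod_hom B -> B' *m B = 1%:M -> K_covered K M N -> K_covered K M N1.
Proof.
move=> homB B'B covN w nzw.
have kB : klinear K B by move=> k _; apply: homB.
have QB : avg x (M := N) (N := N1) B' *m B = 1%:M.
  have := avg_comp nK intx B' (@klinear1 _ _ K N1) kB.
  by rewrite !mul1mx B'B avg1.
have [|Phi kPhi nz] := covN (w *m avg x (M := N) (N := N1) B').
  by apply: contraNneq nzw => wC; rewrite -[w]mulmx1 -QB mulmxA wC mul0mx.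
exists (avg x (M := N) (N := N1) B' *m Phi); last by rewrite mulmxA.
by apply: klinear_comp => //; apply: avg_klinear.
Qed.

Lemma covered_linked M N : (0 < hmod_deg N)%N -> K_covered K M N -> linked K M N.
Proof.
move=> N0 covN; have [|Phi kPhi nz] := covN (delta_mx 0 (Ordinal N0)).
  apply/eqP => /matrixP/(_ 0 (Ordinal N0))/eqP.
  by rewrite !mxE !eqxx oner_eq0.
by exists Phi => //; apply: contraNneq nz => ->; rewrite mulmx0.
Qed.

Lemma hmod_tr1 M : \tr (M 1) = (hmod_deg M)%:R.
Proof. by rewrite hmod_act1 mxtrace1. Qed.

(* Restricting to K the decomposition of L (x) M exhibits the normalised
   character of M as a convex combination, with positive weights, of those of
   all modules linked to M.                                                *)
Lemma linked_decomposition M : (0 < hmod_deg M)%N ->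
  exists d m (Y : 'I_m -> hmodule H),
  [/\ forall i, simple_hmodule (Y i) /\ linked K M (Y i),
      forall k, k \in K -> \tr (M k) *+ d = \sum_i \tr (Y i k)
    & forall N, simple_hmodule N -> linked K M N ->
        exists i, forall a, \tr (N a) = \tr (Y i a)].
Proof.
move=> M0.
have [m [Y [simY covY trY homY]]] := @composition_factors _ H (K_covered K M)
  (@covered_sub M) (@covered_quot M) _ (@quot_tens_covered _ H K nK M).
exists (\dim {:hquot nK}), m, Y; split=> [i|k Kk|N simN [Psi kPsi nz]].
- by split=> //; apply: covered_linked => //; case: (simY i).
- by rewrite -trY quot_tensK // mxtrace_tens mxtrace1 mulr_natl.
- by have [Phi homP nzP] := quot_tens_hom nK kPsi nz; apply: homY homP nzP.
Qed.

Section Ratio.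
Variables (R : realFieldType) (r : {additive F -> R}) (k : H).
Hypothesis Kk : k \in K.

(** A maximum needs ordered values, so characters are read through the additive map [r], later the
    real and the imaginary part. *)
Let ratio M := r (\tr (M k)) / (hmod_deg M)%:R.

Let eq_ratio M N : (forall a, \tr (M a) = \tr (N a)) -> ratio M = ratio N.
Proof.
move=> E; rewrite /ratio E; congr (_ / _%:R).
by apply/eqP; rewrite -(@eqr_nat F) -!hmod_tr1 E.
Qed.

Let bad M := simple_hmodule M /\
  exists N, [/\ simple_hmodule N, linked K M N & ratio M != ratio N].

(** [ratio M] is the mean of the [ratio (Y i)] with weights [hmod_deg (Y i)]. A factor exceeding it
    is bad, being linked back to [M]; if none does, all factors share its ratio, and so does [N], a
    contradiction. *)
Let bad_step M : bad M -> exists2 M', bad M' & ratio M < ratio M'.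
Proof.
case=> simM [N [simN adjN neN]]; have M0 := simM.1.
have [d [m [Y [Yadj trY covY]]]] := linked_decomposition M0.
have [i0 Ei0] := covY N simN adjN.
case: (pselect (exists i, ratio M < ratio (Y i))) => [[i lti]|none].
  exists (Y i) => //; split; first exact: (Yadj i).1.
  exists M; split=> //; last by rewrite gt_eqF.
  exact: (linked_sym nK intx counitx (Yadj i).2).
case/eqP: neN; rewrite (eq_ratio Ei0).
have degY i : (0 : R) < (hmod_deg (Y i))%:R by rewrite ltr0n; case: (Yadj i) => -[].
have le i : 0 <= ratio M * (hmod_deg (Y i))%:R - r (\tr (Y i k)).
  rewrite subr_ge0 -ler_pdivrMr // leNgt; apply/negP => lti.
  by apply: none; exists i.
have sum0 : \sum_i (ratio M * (hmod_deg (Y i))%:R - r (\tr (Y i k))) = 0.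
  rewrite sumrB -mulr_sumr -(raddf_sum r) -trY // raddfMn -natr_sum.
  (* Degrees are traces at 1, so this is the decomposition taken at [1], an element of [K]. *)
  have -> : (\sum_i hmod_deg (Y i) = hmod_deg M * d)%N.
    apply/eqP; rewrite -(@eqr_nat F) natr_sum natrM mulr_natr -hmod_tr1.
    by rewrite trY ?(nhs_one nK) //; apply/eqP/eq_bigr => i _; rewrite hmod_tr1.
  by rewrite natrM mulrA /ratio divfK ?mulr_natr ?subrr // pnatr_eq0 -lt0n.
have /eqP := @psumr_eq0P _ _ _ _ (fun i _ => le i) sum0 i0 isT.
by rewrite subr_eq0 => /eqP E; rewrite [RHS]/ratio -E mulfK // gt_eqF.
Qed.

(* Maximum principle: [bad_step] climbs forever in a finite set of ratios. *)
Lemma linked_ratio M N : simple_hmodule M -> simple_hmodule N -> linked K M N ->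
  r (\tr (M k)) / (hmod_deg M)%:R = r (\tr (N k)) / (hmod_deg N)%:R.
Proof.
move=> simM simN adjMN; apply/eqP; apply: contrapT => /negP neMN.
have badM : bad M by split=> //; exists N.
have [m [Y covY]] := finite_simple_chars H.
have [i0 /eq_ratio Ei0] := covY M simM.
(* The list [Y] contains bad modules only up to their character, so [P] marks the indices whose
   ratio some bad module attains. *)
pose P i := `[< exists2 M', bad M' & ratio M' = ratio (Y i) >].
have Pi0 : P i0 by apply/asboolP; exists M.
case: (@arg_maxP _ _ _ i0 P (fun i => ratio (Y i)) Pi0) => i /asboolP[M1 bad1 E1] maxi.
have [M2 bad2 lt12] := bad_step bad1.
have [j /eq_ratio Ej] := covY M2 bad2.1.
have /maxi : P j by apply/asboolP; exists M2.
by rewrite /= leNgt -Ej -E1 lt12.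
Qed.

End Ratio.
End Harmonic.

(** * The relation on [Irr H] and normalised restrictions to [K] *)

Theorem theorem4p3 (R : realType) (H : hopfAlgType R[i]) (K : {vspace H})
    (nK : normal_hopf_subalg K) (ssH : semisimple H) (chi mu : Irr H) :
  irr_sim nK chi mu <->
  (irr_char chi 1 : R[i])^-1 *: res_char K (irr_char chi) =
  (irr_char mu 1 : R[i])^-1 *: res_char K (irr_char mu).
Proof.
have [x intx counitx] := normalized_integral nK ssH.
set N := irr_mod chi; set M := irr_mod mu.
have simN : simple_hmodule N := irr_mod_simple chi.
have simM : simple_hmodule M := irr_mod_simple mu.
have char_chi h : irr_char chi h = \tr (N h) by rewrite -irr_mod_char hmod_charE.
have char_mu h : irr_char mu h = \tr (M h) by rewrite -irr_mod_char hmod_charE.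
rewrite !char_chi !char_mu !hmod_tr1.
have dN : (hmod_deg N)%:R != 0 :> R[i] by rewrite Num.Theory.pnatr_eq0 -lt0n simN.1.
have dM : (hmod_deg M)%:R != 0 :> R[i] by rewrite Num.Theory.pnatr_eq0 -lt0n simM.1.
have adjE : irr_sim nK chi mu <-> linked K M N.
  by split=> [/(sim_linked intx counitx simN.1)|/(linked_sim nK simN)].
rewrite adjE; split=> [adjMN|E].
  apply/lfunP => y; rewrite !scale_lfunE !res_charE char_chi char_mu.
  set k := vsval y; have Kk : k \in K by apply: subvsP.
  (* The maximum principle is applied to real and imaginary parts separately, with denominators
     cleared. *)
  have ratio (r : {additive R[i] -> R}) :
      r (\tr (M k) *+ hmod_deg N) = r (\tr (N k) *+ hmod_deg M).
    have := linked_ratio nK intx counitx r Kk simM simN adjMN.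
    move/eqP; rewrite eqr_div ?Num.Theory.pnatr_eq0 -?lt0n ?simM.1 ?simN.1 //.
    by rewrite !mulr_natr !raddfMn => /eqP.
  have Et : \tr (M k) *+ hmod_deg N = \tr (N k) *+ hmod_deg M.
    apply/eqP; rewrite eq_complex.
    by rewrite (ratio (@complex.Re R : {additive Rcomplex R -> R}))
      (ratio (@complex.Im R : {additive Rcomplex R -> R})) !eqxx.
  rewrite -[LHS]/(_ * _) -[RHS]/(_ * _) mulrC [RHS]mulrC.
  by apply/eqP; rewrite eqr_div // !mulr_natr Et.
apply: (@proportional_linked _ H K nK x M N ((hmod_deg N)%:R / (hmod_deg M)%:R)) => //.
- exact: Num.Theory.pchar_num.
- exact: simM.1.
- by rewrite mulf_neq0 ?invr_eq0.
move=> k Kk; have /lfunP/(_ (vsproj K k)) := E.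
rewrite !scale_lfunE !res_charE vsprojK // char_chi char_mu => Ek.
by rewrite -mulrA [X in _ * X](esym Ek) mulrA mulfV // mul1r.
Qed.
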